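(* Let $0<a<b<\infty$, let $x_1<\cdots<x_n$ be real numbers in $[a,b]$, let $\underline{s}=(s_1,\ldots,s_n)^T\in\mathbb{C}^{n}$, and let $P_n$ be the $n\times n$ Pick matrix with entries $(P_n)_{jk}=\frac{s_j+s_k}{x_j+x_k}$, $1\le j,k\le n$. Then, for every $0<\epsilon<1$, \[ \mathrm{rank}_\epsilon(P_n)\le 2\left\lceil\frac{\log(4b/a)\,\log(4/\epsilon)}{\pi^2}\right\rceil. \] The bound remains valid if $\log(4b/a)$ is replaced by $\mu(a/b)$, where $\mu$ is the Gr\''otzsch ring function.
   Context: $\sigma_1(X)\ge\cdots\ge\sigma_n(X)\ge 0$ denote the singular values of an $n\times n$ matrix $X$, with the convention $\sigma_{n+1}(X)=0$, and $\|X\|_2=\sigma_1(X)$. For $0<\epsilon<1$, the $\epsilon$-rank is $\mathrm{rank}_\epsilon(X)=\min\{k\ge 0:\sigma_{k+1}(X)\le\epsilon\|X\|_2\}$. The Gr\''otzsch ring function is $\mu(\lambda)=\frac{\pi}{2}\,K(\sqrt{1-\lambda^2})/K(\lambda)$ for $0<\lambda<1$, where $K(\lambda)=\int_0^1 \frac{dt}{\sqrt{(1-t^2)(1-\lambda^2t^2)}}$ is the complete elliptic integral of the first kind. *)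

(* Defs.v *)
From HB Require Import structures.
From mathcomp Require Import all_boot all_order all_algebra.
From mathcomp Require Import all_classical all_reals all_analysis.
From mathcomp Require Import complex.

Set Implicit Arguments.
Unset Strict Implicit.
Unset Printing Implicit Defensive.

Import Order.TTheory GRing.Theory Num.Theory.
Import numFieldNormedType.Exports.
Local Open Scope ring_scope.
Local Open Scope sesquilinear_scope.
Local Open Scope complex_scope.

(* X^* X is Hermitian, so spectral_diag lists its eigenvalues with
   multiplicity, in an unspecified order; they are real and nonnegative. *)
Definition singular_values (R : realType) (n : nat) (X : 'M[R[i]]_n) : seq R :=
  sort >=%R
    [seq Num.sqrt (complex.Re (spectral_diag (X ^t* *m X) 0 j)) | j <- enum 'I_n].

(* 1-based, as in sigma_1 >= ... >= sigma_n, with sigma_k = 0 for k > n;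
   the index k = 0 is not meaningful. *)
Definition singular_value (R : realType) (n : nat) (X : 'M[R[i]]_n) (k : nat) : R :=
  nth 0 (singular_values X) k.-1.

Definition norm2 (R : realType) (n : nat) (X : 'M[R[i]]_n) : R :=
  singular_value X 1.

(* The minimum over all k : nat is attained in {0, ..., n} when 0 <= eps, since
   sigma_(n+1) = 0; ord_max is the witness of nonemptiness that arg min needs. *)
Definition epsilon_rank (R : realType) (eps : R) (n : nat) (X : 'M[R[i]]_n) : nat :=
  [arg min_(k < (ord_max : 'I_n.+1) |
     (singular_value X k.+1 <= eps * norm2 X)%R) (k : nat)]%N.

Definition pick_mx (R : realType) (n : nat) (x : 'I_n -> R) (s : 'cV[R[i]]_n) :
    'M[R[i]]_n :=
  \matrix_(j, k) ((s j 0 + s k 0) / (x j + x k)%:C).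

(* The integrand is taken to be 0 at t = 1, where the square root vanishes. *)
Definition ellipticK (R : realType) (l : R) : R :=
  \int[lebesgue_measure]_(t in `[0, 1]%classic)
    (Num.sqrt ((1 - t ^+ 2) * (1 - l ^+ 2 * t ^+ 2)))^-1.

Definition grotzsch_mu (R : realType) (l : R) : R :=
  pi / 2 * (ellipticK (Num.sqrt (1 - l ^+ 2)) / ellipticK l).

(* Main.v *)
Require Import Defs.
From mathcomp Require Import all_boot all_order all_algebra.
From mathcomp Require Import all_classical all_reals all_analysis.
From mathcomp Require Import complex.
From mathcomp Require Import measurable_realfun ring lra zify.

Set Implicit Arguments.
Unset Strict Implicit.
Unset Printing Implicit Defensive.

Import Order.TTheory GRing.Theory Num.Theory.
Import numFieldNormedType.Exports.
Local Open Scope ring_scope.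

(** The displacement D P + P D of the Pick matrix P, with D the diagonal matrix
    of the x_j, has rank at most two.  For g(x) = prod_i (x - z_i) / (x + z_i)
    with k nodes z_i > 0 this makes P - g(D) P g(D) a matrix of rank at most
    2 k ([blaschke_kernel]), while the norm of g(D) P g(D) is at most
    max g^2 times that of P.  Hence sigma_(2k+1)(P) <= M^2 sigma_1(P) as soon as
    |g| <= M on [a, b] ([pick_singular_value]), and the theorem reduces to the
    choice of nodes with M^2 <= 4 exp (- k pi^2 / mu(a/b)).

    The nodes are those of Zolotarev.  After rescaling, [a, b] is parametrized
    by the quotient x(u) of the theta functions with nome q at u and u + pi,
    where q is such that the smallest value of x(u)^2 is a / b.  The
    addition formulas ([theta3_add], [theta3_sub]) give
      (x(u) - x(v)) / (x(u) + x(v)) = - q w(u + v) w(u - v)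
    with w a quotient of theta functions of nome q^2, and Jacobi's triple product
    shows that the product of w over N equally spaced translates of u is, up to
    sign, the function w of nome q^(2N) at N u ([theta_ratio_subdivide]).  As
    |w| <= 2, taking for z_j the values of x at the k odd multiples of
    pi / (2 k) in [0, pi] gives M <= 2 q^k ([zolotarev_bound]).

    It remains to see that ln q <= - pi^2 / (2 mu(a/b)).  Since
    mu(l) mu(l') = pi^2 / 4 for complementary moduli, this says
    mu(l') <= - (ln q) / 2 at l = a / b.  Both sides are doubled when q is
    replaced by q^2, by Landen's transformation of K ([ellipticK_landen]) and
    the corresponding duplication formula for theta constants
    ([comod_landen]).  Iterating, it suffices to know that the left side exceeds
    the right one by at most a constant at small nomes, which follows from the
    logarithmic growth of K ([ellipticK_compl_le]).  The same iteration in the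
    modulus gives mu(l) <= ln (4 / l), hence the first bound. *)

(** * Singular values and low rank approximation *)

Section SingularValues.
Local Open Scope sesquilinear_scope.
Local Open Scope complex_scope.
Variables (R : realType) (n : nat).
Local Notation C := R[i].
Implicit Types (X Y : 'M[C]_n) (v w : 'cV[C]_n).

Definition sqnorm m (v : 'cV[C]_m) : C := \sum_j `|v j 0| ^+ 2.

Lemma sqnorm_ge0 m (v : 'cV[C]_m) : 0 <= sqnorm v.
Proof. by apply: sumr_ge0 => j _; rewrite exprn_ge0. Qed.

Lemma sqnormE m (v : 'cV[C]_m) : (v ^t* *m v) 0 0 = sqnorm v.
Proof.
by rewrite mxE; apply: eq_bigr => j _; rewrite !mxE mulrC -normCK.
Qed.

Lemma sqnorm_unitary (V : 'M[C]_n) v : V \is unitarymx -> sqnorm (V *m v) = sqnorm v.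
Proof.
move=> Vu; rewrite -!sqnormE trmx_mul map_mxM mulmxA -(mulmxA _ (V ^t*)).
have -> : V ^t* *m V = 1%:M by rewrite -invmx_unitary// mulVmx ?unitarymx_unit.
by rewrite mulmx1.
Qed.

Let G X := X ^t* *m X.
Let sd X := spectral_diag (G X).
Let sm X := spectralmx (G X).

Lemma gram_spectral X : G X = (sm X) ^t* *m diag_mx (sd X) *m sm X.
Proof.
rewrite /sm -invmx_unitary ?spectral_unitarymx//.
apply/orthomx_spectralP/normalmxP.
by rewrite /G !trmx_mul !map_mxM trmxCK.
Qed.

Lemma sqnorm_spectral X v :
  sqnorm (X *m v) = \sum_j sd X 0 j * `|(sm X *m v) j 0| ^+ 2.
Proof.
rewrite -sqnormE trmx_mul map_mxM mulmxA -(mulmxA _ (X ^t*)) -/(G X) gram_spectral.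
rewrite !mulmxA -[_ *m sm X *m v]mulmxA.
have -> : v ^t* *m sm X ^t* = (sm X *m v) ^t*.
  by rewrite trmx_mul map_mxM.
rewrite mul_mx_diag mxE; apply: eq_bigr => j _; rewrite !mxE.
by rewrite normCK; ring.
Qed.

Lemma spectral_diag_ge0 X j : 0 <= sd X 0 j.
Proof.
have smU := spectral_unitarymx (G X).
have := sqnorm_ge0 (X *m ((sm X) ^t* *m delta_mx j 0)).
rewrite sqnorm_spectral mulmxA (unitarymxP smU) mul1mx (bigD1 j)//= !mxE !eqxx/=.
rewrite normr1 expr1n mulr1 big1 ?addr0// => i ij.
by rewrite !mxE (negbTE ij) normr0 expr0n mulr0.
Qed.

Let sg X j : R := Num.sqrt (complex.Re (sd X 0 j)).

Lemma sgK X j : ((sg X j) ^+ 2)%:C = sd X 0 j.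
Proof.
have := spectral_diag_ge0 X j; rewrite /sg; case: (sd X 0 j) => a b.
rewrite lecE/= => /andP[/eqP -> a0].
by rewrite sqr_sqrtr.
Qed.

Lemma singular_value_le_max X j : sg X j <= norm2 X.
Proof.
rewrite /norm2 /singular_value /= /singular_values.
set s := [seq _ | _ <- _].
have sj : sg X j \in sort >=%R s by rewrite mem_sort; apply/mapP; exists j; rewrite ?mem_enum.
have st : sorted >=%R (sort >=%R s) by apply: sort_sorted => x y; exact: le_total.
case: (sort >=%R s) sj st => [//|y s'] /=.
rewrite inE => /predU1P[->//|sj]; rewrite (path_sortedE ge_trans) => /andP[/allP + _].
exact.
Qed.

Lemma singular_values_ge0 X k : 0 <= nth 0 (singular_values X) k.
Proof.
have [ks|ks] := ltnP k (size (singular_values X)); last by rewrite nth_default.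
apply: (@allP _ (fun x : R => 0 <= x) (singular_values X)); last exact: mem_nth.
apply/allP => x; rewrite /singular_values mem_sort => /mapP[j _ ->].
exact: sqrtr_ge0.
Qed.

Lemma sqnorm_norm2 X v : sqnorm (X *m v) <= ((norm2 X) ^+ 2)%:C * sqnorm v.
Proof.
rewrite sqnorm_spectral -(sqnorm_unitary v (spectral_unitarymx (G X))) -/(sm X) mulr_sumr.
apply: ler_sum => j _; apply: ler_wpM2r; first by rewrite exprn_ge0.
rewrite -sgK lecR; apply: lerXn2r; rewrite ?nnegrE ?sqrtr_ge0//.
  exact: singular_values_ge0.
exact: singular_value_le_max.
Qed.

(** The easy half of the Eckart--Young theorem: were m + 1 singular values
    larger than t, the span of their right singular vectors, on which X
    stretches by more than t, would meet the kernel of Y. *)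
Lemma singular_value_le_rank X Y m (t : R) : 0 <= t -> (\rank Y <= m)%N ->
  (forall v, sqnorm ((X - Y) *m v) <= (t ^+ 2)%:C * sqnorm v) ->
  singular_value X m.+1 <= t.
Proof.
move=> t0 rY Yt; rewrite leNgt; apply/negP; rewrite /singular_value/= => tlt.
(* Indices of the large singular values; V below collects the corresponding
   eigenvectors of the Gram matrix. *)
pose J := [set j | t < sg X j].
have mJ : (m < #|J|)%N.
  pose s := singular_values X.
  have ms : (m < size s)%N.
    by rewrite ltnNge; apply: contraTN tlt => h; rewrite nth_default// -leNgt.
  have st : sorted >=%R s by apply: sort_sorted => x y; exact: le_total.
  have -> : #|J| = count (fun x => t < x) s.
    rewrite /s /singular_values count_sort count_map cardE size_filter.
    by rewrite enumT; apply: eq_count => j /=; rewrite inE.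
  rewrite -(cat_take_drop m.+1 s) count_cat.
  have -> : count (fun x => t < x) (take m.+1 s) = m.+1; last exact: leq_addr.
  have sz : size (take m.+1 s) = m.+1 by rewrite size_takel.
  rewrite -[RHS]sz; apply/eqP; rewrite -all_count; apply/(all_nthP 0) => i.
  rewrite sz => im; rewrite nth_take//; apply: (lt_le_trans tlt).
  apply: (sorted_leq_nth ge_trans (@lexx _ _) 0 st) => //.
  by rewrite inE (leq_trans im).
have smU := spectral_unitarymx (G X); rewrite -/(sm X) in smU.
pose V : 'M[C]_(n, #|J|) := \matrix_(i, k) (sm X) ^t* i (enum_val k).
have : kermx (Y *m V)^T != 0.
  rewrite -mxrank_eq0 mxrank_ker mxrank_tr subn_eq0 -ltnNge.
  by rewrite (leq_ltn_trans _ mJ)// (leq_trans (mxrankM_maxl _ _)).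
move=> /rowV0Pn[w0 /sub_kermxP w0K w0n].
pose w : 'cV[C]_#|J| := w0^T.
have YVw : Y *m V *m w = 0 by apply: trmx_inj; rewrite trmx_mul trmxK w0K trmx0.
have wn : w != 0 by rewrite /w trmx_eq0.
have smV i k : (sm X *m V) i k = (i == enum_val k)%:R.
  have /matrixP/(_ i (enum_val k)) := unitarymxP smU.
  rewrite !mxE => <-; apply: eq_bigr => l _; by rewrite !mxE.
have smVw k : (sm X *m (V *m w)) (enum_val k) 0 = w k 0.
  rewrite mulmxA mxE (bigD1 k)//= smV eqxx mul1r big1 ?addr0// => l lk.
  by rewrite smV (inj_eq enum_val_inj) eq_sym (negbTE lk) mul0r.
have smVw0 i : i \notin J -> (sm X *m (V *m w)) i 0 = 0.
  move=> iJ; rewrite mulmxA mxE big1// => l _; rewrite smV.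
  case: eqP => [il|_]; last by rewrite mul0r.
  by move: iJ; rewrite il enum_valP.
have sumJ (F : 'I_n -> C) : \sum_j F j * `|(sm X *m (V *m w)) j 0| ^+ 2 =
    \sum_k F (enum_val k) * `|w k 0| ^+ 2.
  rewrite (bigID (mem J))/= [X in _ + X]big1 ?addr0; last first.
    by move=> j jJ; rewrite smVw0// normr0 expr0n mulr0.
  by rewrite big_enum_val; apply: eq_bigr => k _; rewrite smVw.
have := Yt (V *m w).
rewrite mulmxBl (mulmxA Y) YVw subr0 sqnorm_spectral sumJ.
rewrite -(sqnorm_unitary (V *m w) smU) /sqnorm.
rewrite [X in _ * X](eq_bigr (fun j => 1 * `|(sm X *m (V *m w)) j 0| ^+ 2)); last first.
  by move=> j _; rewrite mul1r.
rewrite (sumJ (fun=> 1)) mulr_sumr -subr_le0 -sumrB; apply/negP/negbT.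
have term k : 0 <= sd X 0 (enum_val k) * `|w k 0| ^+ 2 - (t ^+ 2)%:C * (1 * `|w k 0| ^+ 2).
  rewrite mul1r -mulrBl mulr_ge0 ?exprn_ge0//.
  rewrite -sgK -rmorphB/= ler0c subr_ge0 lerXn2r ?nnegrE ?sqrtr_ge0//.
  by have := enum_valP k; rewrite inE => /ltW.
have /existsP[k wk] : [exists k, w k 0 != 0].
  apply: contraNT wn; rewrite negb_exists => /forallP w0'.
  by apply/eqP/colP => k; rewrite [RHS]mxE; apply/eqP; exact: negbNE (w0' k).
apply: lt_geF; rewrite (bigD1 k)//= ltr_pwDl ?sumr_ge0//.
rewrite mul1r -mulrBl mulr_gt0 ?exprn_gt0 ?normr_gt0//.
rewrite -sgK -rmorphB/= (ltcR 0) subr_gt0 ltrXn2r ?nnegrE ?sqrtr_ge0//.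
by have := enum_valP k; rewrite inE.
Qed.

End SingularValues.

(** * The Pick matrix as a numerically low rank matrix *)

Section PickMatrix.
Local Open Scope complex_scope.
Variable R : realType.
Local Notation C := R[i].

(** With D the diagonal matrix of the g j, the matrix D X D is the error of a
    low rank approximation of X and has norm at most M^2 times that of X. *)
Lemma singular_value_diag_compress n (X : 'M[C]_n) (g : 'I_n -> R) (M : R) m :
  0 <= M -> (forall j, `|g j| <= M) ->
  (\rank (X - \matrix_(j, l) ((g j)%:C * X j l * (g l)%:C))%R <= m)%N ->
  singular_value X m.+1 <= M ^+ 2 * norm2 X.
Proof.
move=> M0 gM rk.
apply: singular_value_le_rank rk _.
  by rewrite mulr_ge0 ?sqr_ge0 ?singular_values_ge0.
move=> v; rewrite opprB addrC subrK.
pose D : 'M[C]_n := diag_mx (\row_j (g j)%:C).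
have DE (w : 'cV[C]_n) j : (D *m w) j 0 = (g j)%:C * w j 0.
  by rewrite mul_diag_mx !mxE.
have -> : \matrix_(j, l) ((g j)%:C * X j l * (g l)%:C) = D *m X *m D.
  by rewrite mul_mx_diag mul_diag_mx; apply/matrixP => j l; rewrite !mxE.
have DM (w : 'cV[C]_n) : sqnorm (D *m w) <= (M ^+ 2)%:C * sqnorm w.
  rewrite /sqnorm mulr_sumr; apply: ler_sum => j _; rewrite DE normrM exprMn.
  apply: ler_wpM2r; first exact: exprn_ge0.
  rewrite normc_def/= expr0n addr0 sqrtr_sqr -rmorphXn/= lecR.
  by rewrite lerXn2r ?nnegrE.
have M2 : (0 : C) <= (M ^+ 2)%:C by rewrite (lecR 0) sqr_ge0.
rewrite -!mulmxA; apply: (le_trans (DM _)).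
apply: (le_trans (ler_wpM2l M2 (sqnorm_norm2 X _))).
rewrite mulrA; apply: (@le_trans _ _ ((M ^+ 2)%:C * ((norm2 X) ^+ 2)%:C * ((M ^+ 2)%:C * sqnorm v))).
  by apply: ler_wpM2l => //; rewrite mulr_ge0// (lecR 0) sqr_ge0.
rewrite mulrA -!rmorphM/= le_eqVlt; apply/orP; left; apply/eqP.
by congr (_%:C * _); ring.
Qed.

Lemma mxrank_sum_outer n k (u v : 'I_k -> 'I_n -> C) :
  (\rank (\matrix_(j, l) \sum_i u i j * v i l)%R <= k)%N.
Proof.
have -> : \matrix_(j, l) \sum_i u i j * v i l =
    (\matrix_(j, i) u i j) *m (\matrix_(i, l) v i l).
  by apply/matrixP => j l; rewrite !mxE; apply: eq_bigr => i _; rewrite !mxE.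
by rewrite (leq_trans (mxrankM_maxl _ _))// rank_leq_col.
Qed.

(** For h(x) = (x - z) / (x + z), the kernel (1 - h(x) h(y)) / (x + y) is
    2 z / ((x + z) (y + z)), of rank one; telescoping over the nodes z gives a
    kernel of rank k for the product of k such factors. *)
Lemma blaschke_kernel (k : nat) (z : nat -> R) : (forall i, 0 < z i) ->
  exists u : nat -> R -> R, forall x y, 0 < x -> 0 < y ->
    (1 - (\prod_(i < k) ((x - z i) / (x + z i))) *
         (\prod_(i < k) ((y - z i) / (y + z i)))) / (x + y) =
    \sum_(i < k) (2 * z i) * (u i x * u i y).
Proof.
move=> z0; pose g m x := \prod_(i < m) ((x - z i) / (x + z i)).
(* The partial products weight the rank one terms in the telescoping sum. *)
exists (fun i x => g i x / (x + z i)) => x y x0 y0; rewrite -/(g k x) -/(g k y).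
elim: k => [|k IH]; first by rewrite /g !big_ord0 mulr1 subrr mul0r.
rewrite big_ord_recr/= -IH /g !big_ord_recr/= -/(g k x) -/(g k y).
have zk := z0 k; field.
by rewrite !gt_eqF// addr_gt0.
Qed.

(** The kernel of [blaschke_kernel] gets multiplied by s_j + s_l, that is, it is
    scaled by s once from the left and once from the right, which at most
    doubles its rank. *)
Lemma pick_singular_value n (x : 'I_n -> R) (s : 'cV[C]_n) k (z : nat -> R) (M : R) :
  0 <= M -> (forall i, 0 < z i) -> (forall j, 0 < x j) ->
  (forall j, `|\prod_(i < k) ((x j - z i) / (x j + z i))| <= M) ->
  singular_value (pick_mx x s) (2 * k).+1 <= M ^+ 2 * norm2 (pick_mx x s).
Proof.
move=> M0 z0 x0 gM; apply: singular_value_diag_compress M0 gM _.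
have [u uE] := blaschke_kernel k z0.
pose A : 'M[C]_n := \matrix_(j, l) \sum_(i < k)
  (s j 0 * (2 * z i * u i (x j))%:C) * (u i (x l))%:C.
pose B : 'M[C]_n := \matrix_(j, l) \sum_(i < k)
  ((2 * z i * u i (x j))%:C) * (s l 0 * (u i (x l))%:C).
set Y := (X in \rank X).
have -> : Y = A + B.
  apply/matrixP => j l; rewrite !mxE -big_split/=.
  set g1 := \prod_(i < k) _; set g2 := \prod_(i < k) _.
  transitivity ((s j 0 + s l 0) * ((1 - g1 * g2) / (x j + x l))%:C).
    rewrite rmorphM/= fmorphV/= rmorphB rmorph1 rmorphM/=.
    have : (x j + x l)%:C != 0 :> C.
      by rewrite (inj_eq (@complexI R) _ 0) gt_eqF// addr_gt0.
    by move: (x j + x l)%:C => d d0; field.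
  rewrite /g1 /g2 uE// rmorph_sum mulr_sumr; apply: eq_bigr => i _ /=.
  rewrite !rmorphM/=; ring.
apply: (leq_trans (mxrank_add _ _)); rewrite mul2n -addnn.
by rewrite leq_add// mxrank_sum_outer.
Qed.

Lemma epsilon_rank_le (eps : R) n (X : 'M[C]_n) k :
  0 <= eps -> singular_value X k.+1 <= eps * norm2 X ->
  (epsilon_rank eps X <= k)%N.
Proof.
move=> e0 h; rewrite /epsilon_rank.
have P0 : singular_value X (ord_max : 'I_n.+1).+1 <= eps * norm2 X.
  rewrite /singular_value/= nth_default ?mulr_ge0 ?singular_values_ge0//.
  by rewrite /singular_values size_sort size_map size_enum_ord.
case: arg_minnP => // i Pi imin.
have [kn|kn] := ltnP k n.+1; first exact: (imin (Ordinal kn)).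
by rewrite (leq_trans _ kn)// ltnW.
Qed.

End PickMatrix.

(** * Dominated series *)

Section GeoSeries.
Local Open Scope classical_set_scope.
Local Open Scope ring_scope.
Variable R : realType.
Implicit Types (a b : nat -> R) (c r : R).

Lemma cvg_le_near (I : Type) (F : set_system I) {FF : ProperFilter F}
    (f : I -> R) (l z : R) : f @ F --> l -> (\forall t \near F, f t <= z) -> l <= z.
Proof. by move=> fl fz; rewrite -(cvg_lim _ fl)//; apply: limr_le => //; apply/cvg_ex; exists l. Qed.

Lemma cvg_ge_near (I : Type) (F : set_system I) {FF : ProperFilter F}
    (f : I -> R) (l z : R) : f @ F --> l -> (\forall t \near F, z <= f t) -> z <= l.
Proof. by move=> fl fz; rewrite -(cvg_lim _ fl)//; apply: limr_ge => //; apply/cvg_ex; exists l. Qed.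

Lemma cvg_sum_ord (I : Type) (F : set_system I) {FF : Filter F} n
    (f : 'I_n -> I -> R) (l : 'I_n -> R) : (forall i, f i @ F --> l i) ->
  \sum_i f i t @[t --> F] --> \sum_i l i.
Proof.
elim: n f l => [|n IH] f l fl; first by under eq_cvg do rewrite big_ord0; rewrite big_ord0; exact: cvg_cst.
under eq_cvg do rewrite big_ord_recr/=; rewrite big_ord_recr/=.
by apply: cvgD => //; apply: IH => i; exact: fl.
Qed.

Lemma cvg_prod_ord (I : Type) (F : set_system I) {FF : Filter F} n
    (f : 'I_n -> I -> R) (l : 'I_n -> R) : (forall i, f i @ F --> l i) ->
  \prod_i f i t @[t --> F] --> \prod_i l i.
Proof.
elim: n f l => [|n IH] f l fl; first by under eq_cvg do rewrite big_ord0; rewrite big_ord0; exact: cvg_cst.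
under eq_cvg do rewrite big_ord_recr/=; rewrite big_ord_recr/=.
by apply: cvgM => //; apply: IH => i; exact: fl.
Qed.

Definition series_lim a : R := limn (series a).

Lemma geo_cvg a c r : 0 <= r < 1 -> (forall i, `|a i| <= c * r ^+ i) ->
  cvgn (series a).
Proof.
move=> /andP[r0 r1] h; apply: normed_cvg.
apply: (@series_le_cvg _ _ (geometric c r)) => [i|i|i|].
- exact: normr_ge0.
- exact: le_trans (normr_ge0 _) (h i).
- exact: h.
- by apply: is_cvg_geometric_series; rewrite ger0_norm.
Qed.

Lemma geo_sum_le c r n : 0 <= c -> 0 <= r < 1 ->
  \sum_(i < n) c * r ^+ i <= c / (1 - r).
Proof.
move=> c0 /andP[r0 r1]; have r1' : 0 < 1 - r by rewrite subr_gt0.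
rewrite -mulr_sumr ler_pdivlMr// -mulrA ler_piMr//.
rewrite mulrC -opprB mulNr -subrX1 opprB lerBlDr lerDl exprn_ge0//.
Qed.

Lemma geo_tail a c r N : 0 <= r < 1 -> (forall i, `|a i| <= c * r ^+ i) ->
  `|series_lim a - \sum_(i < N) a i| <= c * r ^+ N / (1 - r).
Proof.
move=> r01 h; have [r0 r1] := andP r01.
have c0 : 0 <= c by have := le_trans (normr_ge0 _) (h 0%N); rewrite expr0 mulr1.
have cv := geo_cvg r01 h.
have cv' : (fun n => `|series a n - \sum_(i < N) a i|) @ \oo --> `|series_lim a - \sum_(i < N) a i|.
  by apply: cvg_norm; apply: cvgB => //; exact: cvg_cst.
apply: (cvg_le_near cv'); near=> n.
have nN : (N <= n)%N by near: n; exact: nbhs_infty_ge.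
rewrite /series/= big_mkord -(subnKC nN) big_split_ord/= addrAC subrr add0r.
apply: (le_trans (ler_norm_sum _ _ _)).
apply: (@le_trans _ _ (\sum_(i < n - N) (c * r ^+ N) * r ^+ i)).
  by apply: ler_sum => i _; rewrite -mulrA -exprD h.
by apply: geo_sum_le => //; rewrite mulr_ge0// exprn_ge0.
Unshelve. all: end_near. Qed.

(** Tannery's theorem with a geometric dominating sequence, along any filter. *)
Lemma tannery (I : Type) (F : set_system I) {FF : ProperFilter F}
    (a : I -> nat -> R) b c r : 0 <= r < 1 ->
  (\forall t \near F, forall i, `|a t i| <= c * r ^+ i) ->
  (forall i, a t i @[t --> F] --> b i) ->
  series_lim (a t) @[t --> F] --> series_lim b.
Proof.
move=> r01 ha ab; have [r0 r1] := andP r01; have r1' : 0 < 1 - r by rewrite subr_gt0.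
have hb i : `|b i| <= c * r ^+ i.
  apply: (cvg_le_near (cvg_norm (ab i))).
  by near=> t; have : forall i, `|a t i| <= c * r ^+ i by near: t.
apply/cvgrPdist_le => e e0.
have /cvgrPdist_le/(_ (e / 4)) : (fun N => c / (1 - r) * r ^+ N) @ \oo --> (0 : R).
  rewrite -[X in _ --> X](mulr0 (c / (1 - r))); apply: cvgM; first exact: cvg_cst.
  by apply: cvg_expr; rewrite ger0_norm.
case=> [|N _ hN]; first by rewrite divr_gt0.
have {}hN : c * r ^+ N / (1 - r) <= e / 4.
  have := hN N (leqnn N); rewrite /= sub0r normrN.
  by apply: le_trans; rewrite mulrAC ler_norm.
have cvN : \sum_(i < N) a t i @[t --> F] --> \sum_(i < N) b i.
  by apply: cvg_sum_ord => i; exact: ab.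
have /cvgrPdist_le/(_ (e / 4)) := cvN; rewrite divr_gt0// => /(_ isT) cvN'.
near=> t.
have hat : forall i, `|a t i| <= c * r ^+ i by near: t.
have h1 := le_trans (geo_tail N r01 hat) hN.
have h2 := le_trans (geo_tail N r01 hb) hN.
have h3 : `|\sum_(i < N) b i - \sum_(i < N) a t i| <= e / 4 by near: t.
move: h1 h2 h3; rewrite !ler_norml => /andP[? ?] /andP[? ?] /andP[? ?].
apply/andP; split; lra.
Unshelve. all: end_near. Qed.

Lemma series_lim_cvg a c r : 0 <= r < 1 -> (forall i, `|a i| <= c * r ^+ i) ->
  (fun n => \sum_(i < n) a i) @ \oo --> series_lim a.
Proof.
move=> r01 h; have := geo_cvg r01 h; rewrite /cvg_to/= => cv.
by apply: cvg_trans cv; apply: near_eq_cvg; near=> n; rewrite /series/= big_mkord.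
Unshelve. all: end_near. Qed.

Lemma series_lim_finite a n : (forall i, (n <= i)%N -> a i = 0) -> series_lim a = \sum_(i < n) a i.
Proof.
move=> h; apply: cvg_lim => //; apply: cvg_near_cst; near=> m.
have nm : (n <= m)%N by near: m; exact: nbhs_infty_ge.
rewrite /series/= big_mkord -(subnKC nm) big_split_ord/= [X in _ + X]big1 ?addr0//.
by move=> i _; rewrite h// leq_addr.
Unshelve. all: end_near. Qed.

End GeoSeries.

(** * Series indexed by the integers *)

Section Bilateral.
Local Open Scope classical_set_scope.
Local Open Scope ring_scope.
Variable R : realType.
Implicit Types (f a b w : int -> R) (c r : R).

(** Bilateral sums run over the ranges -M <= m < M, which are stable under
    m -> -1 - m. *)
Definition zpartial M f : R := \sum_(i < M) (f (Posz i) + f (Negz i)).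
Definition zsum f : R := series_lim (fun i => f (Posz i) + f (Negz i)).
Definition zdom c r f := forall i : nat, `|f (Posz i)| <= c * r ^+ i /\ `|f (Negz i)| <= c * r ^+ i.

Lemma zdom_pair c r f i : zdom c r f -> `|f (Posz i) + f (Negz i)| <= (2 * c) * r ^+ i.
Proof.
move=> /(_ i)[h1 h2]; apply: (le_trans (ler_normD _ _)).
by rewrite -mulrA mulr_natl mulr2n lerD.
Qed.

Lemma zpartial_cvg c r f : 0 <= r < 1 -> zdom c r f -> (zpartial ^~ f) @ \oo --> zsum f.
Proof. by move=> r01 h; apply: (series_lim_cvg r01 (fun i => zdom_pair i h)). Qed.

Definition zrange M : seq int := [seq Posz i | i <- iota 0 M] ++ [seq Negz i | i <- iota 0 M].

Lemma zpartialE M f : zpartial M f = \sum_(m <- zrange M) f m.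
Proof.
rewrite big_cat/= !big_map /zpartial big_split/=.
by rewrite -/(index_iota 0 _) -[in RHS](subn0 M) -!/(index_iota 0 M) !big_mkord.
Qed.

Lemma mem_zrange M m : (m \in zrange M) = (- M%:Z <= m < M%:Z).
Proof.
rewrite mem_cat; case: m => i.
  rewrite mem_map ?mem_iota//=; last by move=> ? ? [].
  have -> : (Posz i \in [seq Negz i | i <- iota 0 M]) = false by apply/negP => /mapP[].
  lia.
rewrite orbC mem_map ?mem_iota//=; last by move=> ? ? [].
have -> : (Negz i \in [seq Posz i | i <- iota 0 M]) = false by apply/negP => /mapP[].
lia.
Qed.

Lemma zrange_uniq M : uniq (zrange M).
Proof.
rewrite cat_uniq !map_inj_uniq ?iota_uniq/=; try by move=> ? ? [].
by rewrite andbT; apply/hasPn => _ /mapP[i _ ->]; apply/negP => /mapP[].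
Qed.

Definition box M : seq (int * int) := [seq (m, n) | m <- zrange M, n <- zrange M].

Lemma box_sum M a b : \sum_(u <- box M) a u.1 * b u.2 = zpartial M a * zpartial M b.
Proof.
rewrite !zpartialE big_allpairs_dep/= mulr_suml; apply: eq_bigr => m _.
by rewrite mulr_sumr.
Qed.

Lemma mem_box M u : (u \in box M) = (- M%:Z <= u.1 < M%:Z) && (- M%:Z <= u.2 < M%:Z).
Proof.
rewrite -!mem_zrange; apply/allpairsP/andP => [[[m n]/= [? ? ->]]//|[? ?]].
by exists u; split => //; rewrite -surjective_pairing.
Qed.

Lemma box_uniq M : uniq (box M).
Proof. by apply: allpairs_uniq; rewrite ?zrange_uniq// => -[? ?] [? ?]. Qed.

(** The bijections of the integer lattice onto its points (m, n) with m + n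
    even and odd respectively. *)
Definition diag_even (u : int * int) := (u.1 + u.2, u.1 - u.2).
Definition diag_odd (u : int * int) := (u.1 + u.2 + 1, u.1 - u.2).

Lemma sum_subseq (I : eqType) (s1 s2 : seq I) (f g : I -> R) :
  uniq s1 -> uniq s2 -> {subset s1 <= s2} -> (forall i, `|f i| <= g i) ->
  `|\sum_(i <- s2) f i - \sum_(i <- s1) f i| <= \sum_(i <- s2) g i - \sum_(i <- s1) g i.
Proof.
move=> u1 u2 s12 fg.
have E (h : I -> R) : \sum_(i <- s2) h i - \sum_(i <- s1) h i = \sum_(i <- s2 | i \notin s1) h i.
  have pm : perm_eq [seq i <- s2 | i \in s1] s1.
    apply: uniq_perm; rewrite ?filter_uniq// => i; rewrite mem_filter/=.
    by case: (boolP (i \in s1)) => // /s12.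
  rewrite -(perm_big _ pm) big_filter/= (bigID (fun i => i \in s1) xpredT)/=.
  by rewrite addrAC subrr add0r.
by rewrite !E; apply: (le_trans (ler_norm_sum _ _ _)); apply: ler_sum.
Qed.

Definition diag_box M := [seq diag_even u | u <- box M] ++ [seq diag_odd u | u <- box M].

Lemma diag_box_uniq M : uniq (diag_box M).
Proof.
rewrite cat_uniq !map_inj_uniq ?box_uniq/=.
- rewrite andbT; apply/hasPn => _ /mapP[[r s] _ ->]; apply/negP => /mapP[[r' s'] _].
  rewrite /diag_even /diag_odd/= => -[]; lia.
- by move=> [r s] [r' s']; rewrite /diag_odd/= => -[h1 h2]; congr pair; lia.
- by move=> [r s] [r' s']; rewrite /diag_even/= => -[h1 h2]; congr pair; lia.
Qed.

Lemma box_sub_diag_box M : {subset box M <= diag_box M}.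
Proof.
move=> [m n]; rewrite mem_box mem_cat/= => mn; apply/orP.
have [k [mk|mk]] : exists k : int, m + n = k * 2 \/ m + n = k * 2 + 1.
  exists ((m + n) %/ 2)%Z; lia.
- left; apply/mapP; exists (k, k - n); last by rewrite /diag_even/=; congr pair; lia.
  rewrite mem_box/=; lia.
- right; apply/mapP; exists (k, k - n); last by rewrite /diag_odd/=; congr pair; lia.
  rewrite mem_box/=; lia.
Qed.

Lemma diag_box_sub_box M : {subset diag_box M <= box (2 * M)}.
Proof.
move=> v; rewrite mem_cat => /orP[] /mapP[[r s]]; rewrite mem_box/= => rs ->;
rewrite mem_box/=; lia.
Qed.

(** Diagonal summation of an absolutely convergent double series: the images
    of a square under diag_even and diag_odd together contain that square and are
    contained in the square twice as large, and the sum over the difference of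
    these squares is a tail of the dominating series. *)
Lemma box_reindex (f : int * int -> R) w c r (l l' : R) :
  0 <= r < 1 -> zdom c r w -> (forall u, `|f u| <= w u.1 * w u.2) ->
  (fun M => \sum_(u <- box M) f u) @ \oo --> l ->
  (fun M => \sum_(u <- box M) f (diag_even u) + \sum_(u <- box M) f (diag_odd u)) @ \oo --> l' ->
  l = l'.
Proof.
move=> r01 wd fw fl fl'.
have ww : (fun M => zpartial M w * zpartial M w) @ \oo --> zsum w * zsum w.
  by apply: cvgM; exact: zpartial_cvg r01 wd.
have ww2 : (fun M => zpartial (2 * M)%N w * zpartial (2 * M)%N w) @ \oo --> zsum w * zsum w.
  apply: (cvg_comp (fun M => (2 * M)%N) (fun M => zpartial M w * zpartial M w) _ ww).
  apply/cvgnyPge => A; near=> n; rewrite mul2n -addnn (leq_trans _ (leq_addr _ _))//.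
  by near: n; exact: nbhs_infty_ge.
have D0 : (fun M => zpartial (2 * M)%N w * zpartial (2 * M)%N w - zpartial M w * zpartial M w) @ \oo --> (0 : R).
  by rewrite -(subrr (zsum w * zsum w)); exact: cvgB.
apply/eqP; rewrite -subr_eq0 -normr_le0 distrC.
apply: (@cvg_le_near R _ \oo _ (fun M => `|(\sum_(u <- box M) f (diag_even u) + \sum_(u <- box M) f (diag_odd u)) - \sum_(u <- box M) f u|
   - (zpartial (2 * M)%N w * zpartial (2 * M)%N w - zpartial M w * zpartial M w))).
  by rewrite -[X in _ --> X]subr0; apply: cvgB => //; apply: cvg_norm; exact: cvgB.
near=> M; rewrite subr_le0 -!box_sum.
have -> : \sum_(u <- box M) f (diag_even u) + \sum_(u <- box M) f (diag_odd u) = \sum_(u <- diag_box M) f u.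
  by rewrite big_cat !big_map.
have h1 := sum_subseq (box_uniq M) (diag_box_uniq M) (@box_sub_diag_box M) fw.
apply: (le_trans h1); rewrite lerD2r.
have w0 u : 0 <= w u.1 * w u.2 by exact: le_trans (normr_ge0 _) (fw u).
have h2 := sum_subseq (diag_box_uniq M) (box_uniq (2 * M)) (@diag_box_sub_box M) fw.
by rewrite -subr_ge0 (le_trans _ h2).
Unshelve. all: end_near. Qed.

(** The ranges are not symmetric about 0, so an odd summand leaves one boundary
    term, which tends to 0. *)
Lemma zpartial_odd_cvg c r f : 0 <= r < 1 -> zdom c r f -> (forall m, f (- m) = - f m) ->
  (zpartial ^~ f) @ \oo --> (0 : R).
Proof.
move=> /andP[r0 r1] fd fo.
have f0 : f 0 = 0 by have := fo 0; rewrite oppr0; lra.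
have E M : zpartial M f = - f (Posz M).
  elim: M => [|M IH]; rewrite /zpartial ?big_ord0 ?f0 ?oppr0// big_ord_recr/= -/(zpartial M f) IH.
  rewrite NegzE fo; ring.
rewrite -oppr0 (_ : zpartial ^~ f = fun M => - f (Posz M)); last by apply/funext => M; rewrite E.
apply: cvgN; apply: norm_cvg0.
apply: (@squeeze_cvgr _ _ _ _ (fun=> 0) (fun M => c * r ^+ M)).
- by near=> M; rewrite normr_ge0; have [] := fd M.
- exact: cvg_cst.
- rewrite -(mulr0 c); apply: cvgM; first exact: cvg_cst.
  by apply: cvg_expr; rewrite ger0_norm.
Unshelve. all: end_near. Qed.

Lemma zpartial_antisym f : (forall i, f (Negz i) = - f (Posz i)) -> forall M, zpartial M f = 0.
Proof. by move=> h M; rewrite /zpartial big1// => i _; rewrite h subrr. Qed.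

End Bilateral.

(** * Theta functions and their addition formulas *)

Section Theta.
Local Open Scope classical_set_scope.
Local Open Scope ring_scope.
Variable R : realType.
Implicit Types (q p x y : R) (m n r s : int).

(** In the classical notation, with nome q, theta3 q x is the Jacobi function
    of index 3 at x / 2, theta3 q (x + pi) is the one of index 4, and theta1 q x
    is the one of index 1 divided by q^(1/4). *)
Definition theta3_term q x m : R := q ^ (m * m) * cos (m%:~R * x).
Definition theta1_term q x m : R := (-1) ^ m * q ^ (m * m + m) * sin ((m%:~R + 2^-1) * x).
Definition theta3 q x : R := zsum (theta3_term q x).
Definition theta1 q x : R := zsum (theta1_term q x).

Lemma sqz_Posz (i : nat) : Posz i * Posz i = Posz (i * i).
Proof. by rewrite PoszM. Qed.
Lemma sqz_Negz (i : nat) : Negz i * Negz i = Posz (i.+1 * i.+1).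
Proof. by rewrite NegzE mulrNN. Qed.
Lemma sqzD_Posz (i : nat) : Posz i * Posz i + Posz i = Posz (i * i + i).
Proof. by rewrite PoszD PoszM. Qed.
Lemma sqzD_Negz (i : nat) : Negz i * Negz i + Negz i = Posz (i * i + i).
Proof. rewrite sqz_Negz NegzE; nia. Qed.

Lemma qsq_dom q : 0 < q < 1 -> zdom 1 q (fun m => q ^ (m * m)).
Proof.
move=> /andP[q0 q1] i; rewrite sqz_Posz sqz_Negz mul1r !ger0_norm ?exprn_ge0 ?(ltW q0)//.
by split; apply: (ler_wiXn2l (ltW q0) (ltW q1)); nia.
Qed.

Lemma theta3_term_dom q x : 0 < q < 1 -> zdom 1 q (theta3_term q x).
Proof.
move=> q01 i; have [h1 h2] := qsq_dom q01 i.
split; rewrite /theta3_term normrM.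
  by apply: le_trans h1; rewrite ler_piMr// cos_max.
by apply: le_trans h2; rewrite ler_piMr// cos_max.
Qed.

Lemma norm_signz m : `|(-1) ^ m| = 1 :> R.
Proof. by case: m => i; rewrite ?NegzE/= ?normfV ?normrX ?normrN1 ?expr1n ?invr1. Qed.

Lemma theta1_term_dom q x : 0 < q < 1 -> zdom 1 q (theta1_term q x).
Proof.
move=> /andP[q0 q1] i.
have h : `|q ^ Posz (i * i + i)| <= q ^+ i.
  rewrite ger0_norm ?exprn_ge0 ?(ltW q0)//.
  by apply: (ler_wiXn2l (ltW q0) (ltW q1)); nia.
split; rewrite /theta1_term !normrM norm_signz !mul1r ?sqzD_Posz ?sqzD_Negz.
  by apply: le_trans h; rewrite ler_piMr// sin_max.
by apply: le_trans h; rewrite ler_piMr// sin_max.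
Qed.

Lemma signz_sqr m : (-1) ^ m * (-1) ^ m = 1 :> R.
Proof.
have /eqP := norm_signz m; rewrite -(@eqrXn2 _ 2) ?normr_ge0 ?ler01//.
by rewrite expr1n real_normK ?num_real// => /eqP; rewrite expr2.
Qed.

Lemma signzD m n : (-1) ^ (m + n) = (-1) ^ m * (-1) ^ n :> R.
Proof. by rewrite expfzDr// oppr_eq0 oner_eq0. Qed.

Lemma signzB m n : (-1) ^ (m - n) = (-1) ^ m * (-1) ^ n :> R.
Proof.
by rewrite signzD -invr_expz; congr (_ * _); apply: mulr1_eq; rewrite signz_sqr.
Qed.

Lemma signzN m : (-1) ^ (- m) = (-1) ^ m :> R.
Proof. by rewrite -(sub0r m) signzB expr0z mul1r. Qed.

Lemma signz1 : (-1) ^ (1 : int) = -1 :> R. Proof. by []. Qed.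

Lemma cosDmpi m x : cos (m%:~R * (x + pi)) = (-1) ^ m * cos (m%:~R * x).
Proof.
have nat_case (i : nat) : cos (i%:R * (x + pi)) = (-1) ^+ i * cos (i%:R * x).
  by rewrite mulrDr mulr_natl (mulr_natl pi) (alternatingn (@cosDpi R)).
case: m => i; first exact: nat_case.
rewrite NegzE mulrNz !mulNr !cosN nat_case; congr (_ * _).
by rewrite -exprz_inv invrN invr1.
Qed.

Lemma theta3_term_pi q x m : theta3_term q (x + pi) m = (-1) ^ m * theta3_term q x m.
Proof. by rewrite /theta3_term cosDmpi mulrCA. Qed.

Let sin_term q x m : R := (-1) ^ m * q ^ (m * m) * sin (m%:~R * x).

Let sin_term_dom q x : 0 < q < 1 -> zdom 1 q (sin_term q x).
Proof.
move=> q01 i; have [h1 h2] := qsq_dom q01 i.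
split; rewrite /sin_term !normrM norm_signz [1 * `|_|]mul1r.
  by apply: le_trans h1; rewrite ler_piMr// sin_max.
by apply: le_trans h2; rewrite ler_piMr// sin_max.
Qed.

Let cos_term q x m : R := (-1) ^ m * q ^ (m * m + m) * cos ((m%:~R + 2^-1) * x).

Let cos_term_antisym q x (i : nat) : cos_term q x (Negz i) = - cos_term q x (Posz i).
Proof.
rewrite /cos_term sqzD_Posz sqzD_Negz.
have E : (Negz i)%:~R = - (i%:R + 1) :> R.
  by rewrite NegzE mulrNz -pmulrn -natr1.
have -> : ((Negz i)%:~R + 2^-1) * x = - (((Posz i)%:~R + 2^-1) * x) :> R.
  by rewrite E -pmulrn; field.
rewrite cosN NegzE -addn1 PoszD signzN signzD signz1.
ring.
Qed.

Let wgt q m : R := 2 * q ^ (m * m).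

Let wgt_dom q : 0 < q < 1 -> zdom 2 q (wgt q).
Proof.
move=> q01 i; have [h1 h2] := qsq_dom q01 i; rewrite !mul1r in h1 h2.
by split; rewrite /wgt normrM ger0_norm// ler_pM2l.
Qed.

Let theta3_term_le q x m : 0 < q -> `|theta3_term q x m| <= q ^ (m * m).
Proof.
move=> q0; rewrite /theta3_term normrM ger0_norm ?exprz_ge0 ?(ltW q0)//.
by rewrite ler_piMr ?exprz_ge0 ?cos_max// (ltW q0).
Qed.

Let theta3_pair_le q x x' y y' (c : R) (u : int * int) : 0 < q -> `|c| <= 1 ->
  `|theta3_term q x u.1 * theta3_term q y u.2 + c * (theta3_term q x' u.1 * theta3_term q y' u.2)| <= wgt q u.1 * wgt q u.2.
Proof.
move=> q0 c1; set A := q ^ (u.1 * u.1); set B := q ^ (u.2 * u.2).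
have AB : 0 <= A * B by rewrite mulr_ge0 ?exprz_ge0 ?(ltW q0).
have h x1 y1 : `|theta3_term q x1 u.1 * theta3_term q y1 u.2| <= A * B.
  by rewrite normrM ler_pM ?theta3_term_le.
apply: (@le_trans _ _ (A * B + A * B)).
  apply: (le_trans (ler_normD _ _)); apply: lerD => //.
  by rewrite normrM -[X in _ <= X]mul1r ler_pM.
rewrite /wgt -/A -/B; lra.
Qed.

Let expD q m n : q != 0 -> q ^ (m + n) = q ^ m * q ^ n.
Proof. by move=> q0; rewrite expfzDr. Qed.

Let exp2 q m : (q ^+ 2) ^ m = q ^ (2 * m).
Proof. by rewrite -exprz_exp. Qed.

(** The product of two theta series of nome q is a double series in
    q^(m^2 + n^2).  The signs cancel the terms with m + n odd, and on
    (m, n) = (r + s, r - s) the exponent is 2 (r^2 + s^2), so that the rest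
    factors into series of nome q^2. *)
Lemma theta3_add q x y : 0 < q < 1 ->
  theta3 q x * theta3 q (y + pi) + theta3 q (x + pi) * theta3 q y =
  2 * theta3 (q ^+ 2) (x + y + pi) * theta3 (q ^+ 2) (x - y + pi).
Proof.
move=> q01; have [q0 q1] := andP q01.
have p01 : 0 < q ^+ 2 < 1 by rewrite exprn_gt0// expr_lte1// ltW.
have [r01 rp01] : 0 <= q < 1 /\ 0 <= q ^+ 2 < 1.
  by case/andP: p01 => p0 p1; rewrite ltW// q1 ltW.
pose f (u : int * int) := theta3_term q x u.1 * theta3_term q (y + pi) u.2 +
  1 * (theta3_term q (x + pi) u.1 * theta3_term q y u.2).
apply: (box_reindex (f := f) (w := wgt q) r01 (wgt_dom q01)).
- by move=> u; apply: theta3_pair_le; rewrite ?normr1.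
- under eq_cvg do rewrite /f big_split/= -mulr_sumr !box_sum mul1r.
  by apply: cvgD; apply: cvgM; apply: zpartial_cvg (theta3_term_dom _ q01).
set p := q ^+ 2; pose A := x + y; pose B := x - y.
have E0 r s : f (diag_even (r, s)) =
    theta3_term p (A + pi) r * theta3_term p (B + pi) s - sin_term p A r * sin_term p B s +
    (theta3_term p (B + pi) r * theta3_term p (A + pi) s - sin_term p B r * sin_term p A s).
  rewrite /f /diag_even/= !theta3_term_pi /theta3_term /sin_term signzB signzD /p !exp2.
  have -> : q ^ ((r + s) * (r + s)) = q ^ (r * r) * q ^ (s * s) * q ^ (2 * (r * s)).
    by rewrite -!expD ?gt_eqF//; congr (_ ^ _); ring.
  have -> : q ^ ((r - s) * (r - s)) = q ^ (r * r) * q ^ (s * s) * q ^ (- (2 * (r * s))).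
    by rewrite -!expD ?gt_eqF//; congr (_ ^ _); ring.
  have qq : q ^ (2 * (r * s)) * q ^ (- (2 * (r * s))) = 1.
    by rewrite -expD ?gt_eqF// subrr.
  have -> : q ^ (2 * (r * r)) = (q ^ (r * r)) ^+ 2.
    by rewrite expr2 -expD ?gt_eqF//; congr (_ ^ _); ring.
  have -> : q ^ (2 * (s * s)) = (q ^ (s * s)) ^+ 2.
    by rewrite expr2 -expD ?gt_eqF//; congr (_ ^ _); ring.
  have c1 : cos ((r + s)%:~R * x) * cos ((r - s)%:~R * y) * 2 =
    cos (r%:~R * A + s%:~R * B) + cos (r%:~R * B + s%:~R * A).
    have -> : r%:~R * A + s%:~R * B = (r + s)%:~R * x + (r - s)%:~R * y.
      by rewrite /A /B rmorphD rmorphB/=; ring.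
    have -> : r%:~R * B + s%:~R * A = (r + s)%:~R * x - (r - s)%:~R * y.
      by rewrite /A /B rmorphD rmorphB/=; ring.
    by rewrite cosD cosB; ring.
  rewrite !cosD in c1.
  transitivity ((-1) ^ r * (-1) ^ s * (q ^ (r * r)) ^+ 2 * (q ^ (s * s)) ^+ 2 *
     (q ^ (2 * (r * s)) * q ^ (- (2 * (r * s)))) *
     (cos ((r + s)%:~R * x) * cos ((r - s)%:~R * y) * 2)); first by ring.
  by rewrite qq c1; ring.
have E0' u : f (diag_even u) =
    theta3_term p (A + pi) u.1 * theta3_term p (B + pi) u.2 - sin_term p A u.1 * sin_term p B u.2 +
    (theta3_term p (B + pi) u.1 * theta3_term p (A + pi) u.2 - sin_term p B u.1 * sin_term p A u.2).
  by case: u => r s; exact: E0.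
have E1 r s : f (diag_odd (r, s)) = 0.
  by rewrite /f /diag_odd/= !theta3_term_pi signzB !signzD signz1; ring.
rewrite (_ : (fun M => _) = fun M => 2 * (zpartial M (theta3_term p (A + pi)) * zpartial M (theta3_term p (B + pi))) -
   2 * (zpartial M (sin_term p A) * zpartial M (sin_term p B))).
  have -> : 2 * theta3 p (A + pi) * theta3 p (B + pi) =
    2 * (theta3 p (A + pi) * theta3 p (B + pi)) - 2 * (0 * 0) by ring.
  apply: cvgB; apply: cvgM; try exact: cvg_cst.
    by apply: cvgM; apply: zpartial_cvg (theta3_term_dom _ p01).
  by apply: cvgM; apply: zpartial_odd_cvg (sin_term_dom _ p01) _ => // m;
    rewrite /sin_term mulrNN mulrNz mulNr sinN signzN; ring.
apply/funext => M.
rewrite [X in _ + X]big1 ?addr0; last by move=> [r s] _.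
rewrite (eq_bigr _ (fun u _ => E0' u)).
rewrite big_split/= !sumrB/=.
rewrite (box_sum M (theta3_term p (A + pi)) (theta3_term p (B + pi))) (box_sum M (sin_term p A) (sin_term p B)).
rewrite (box_sum M (theta3_term p (B + pi)) (theta3_term p (A + pi))) (box_sum M (sin_term p B) (sin_term p A)).
by ring.
Qed.

(** Here the terms with m + n even cancel, and m = r + s + 1, n = r - s leads to
    the half-integral frequencies of theta1. *)
Lemma theta3_sub q x y : 0 < q < 1 ->
  theta3 q x * theta3 q (y + pi) - theta3 q (x + pi) * theta3 q y =
  - 2 * q * theta1 (q ^+ 2) (x + y) * theta1 (q ^+ 2) (x - y).
Proof.
move=> q01; have [q0 q1] := andP q01.
have p01 : 0 < q ^+ 2 < 1 by rewrite exprn_gt0// expr_lte1// ltW.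
have [r01 rp01] : 0 <= q < 1 /\ 0 <= q ^+ 2 < 1.
  by case/andP: p01 => p0 p1; rewrite ltW// q1 ltW.
pose f (u : int * int) := theta3_term q x u.1 * theta3_term q (y + pi) u.2 +
  (- 1) * (theta3_term q (x + pi) u.1 * theta3_term q y u.2).
apply: (box_reindex (f := f) (w := wgt q) r01 (wgt_dom q01)).
- by move=> u; apply: theta3_pair_le; rewrite ?normrN1.
- under eq_cvg do rewrite /f big_split/= -mulr_sumr !box_sum mulN1r.
  by apply: cvgB; apply: cvgM; apply: zpartial_cvg (theta3_term_dom _ q01).
set p := q ^+ 2; pose A := x + y; pose B := x - y.
have E1 r s : f (diag_odd (r, s)) =
    q * (cos_term p A r * cos_term p B s - theta1_term p A r * theta1_term p B s +
    (cos_term p B r * cos_term p A s - theta1_term p B r * theta1_term p A s)).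
  rewrite /f /diag_odd/= !theta3_term_pi /theta3_term /theta1_term /cos_term signzB !signzD signz1 /p !exp2.
  have -> : q ^ ((r + s + 1) * (r + s + 1)) =
      q ^ (r * r + r) * q ^ (s * s + s) * q ^ (2 * (r * s) + r + s) * q ^ (1 : int).
    by rewrite -!expD ?gt_eqF//; congr (_ ^ _); ring.
  have -> : q ^ ((r - s) * (r - s)) =
      q ^ (r * r + r) * q ^ (s * s + s) * q ^ (- (2 * (r * s) + r + s)).
    by rewrite -!expD ?gt_eqF//; congr (_ ^ _); ring.
  have qq : q ^ (2 * (r * s) + r + s) * q ^ (- (2 * (r * s) + r + s)) = 1.
    by rewrite -expD ?gt_eqF// subrr.
  have -> : q ^ (2 * (r * r + r)) = (q ^ (r * r + r)) ^+ 2.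
    by rewrite expr2 -expD ?gt_eqF//; congr (_ ^ _); ring.
  have -> : q ^ (2 * (s * s + s)) = (q ^ (s * s + s)) ^+ 2.
    by rewrite expr2 -expD ?gt_eqF//; congr (_ ^ _); ring.
  pose r' : R := r%:~R + 2^-1; pose s' : R := s%:~R + 2^-1.
  rewrite -/r' -/s'.
  have c1 : cos ((r + s + 1)%:~R * x) * cos ((r - s)%:~R * y) * 2 =
    cos (r' * A + s' * B) + cos (r' * B + s' * A).
    have -> : r' * A + s' * B = (r + s + 1)%:~R * x + (r - s)%:~R * y.
      by rewrite /A /B /r' /s' !rmorphD rmorphN/=; field.
    have -> : r' * B + s' * A = (r + s + 1)%:~R * x - (r - s)%:~R * y.
      by rewrite /A /B /r' /s' !rmorphD rmorphN/=; field.
    by rewrite cosD cosB; ring.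
  rewrite !cosD in c1.
  transitivity (q ^ (1 : int) * (-1) ^ r * (-1) ^ s * (q ^ (r * r + r)) ^+ 2 *
     (q ^ (s * s + s)) ^+ 2 *
     (q ^ (2 * (r * s) + r + s) * q ^ (- (2 * (r * s) + r + s))) *
     (cos ((r + s + 1)%:~R * x) * cos ((r - s)%:~R * y) * 2)); first by ring.
  by rewrite qq c1 expr1z; ring.
have E1' u : f (diag_odd u) =
    q * (cos_term p A u.1 * cos_term p B u.2 - theta1_term p A u.1 * theta1_term p B u.2 +
    (cos_term p B u.1 * cos_term p A u.2 - theta1_term p B u.1 * theta1_term p A u.2)).
  by case: u => r s; exact: E1.
have E0 r s : f (diag_even (r, s)) = 0.
  by rewrite /f /diag_even/= !theta3_term_pi signzB !signzD; ring.
rewrite (_ : (fun M => _) = fun M => - 2 * q * (zpartial M (theta1_term p A) * zpartial M (theta1_term p B))).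
  rewrite -mulrA; apply: cvgM; first exact: cvg_cst.
  by apply: cvgM; apply: zpartial_cvg (theta1_term_dom _ p01).
apply/funext => M.
rewrite [X in X + _]big1 ?add0r; last by move=> [r s] _.
rewrite (eq_bigr _ (fun u _ => E1' u)).
rewrite -mulr_sumr big_split/= !sumrB/=.
rewrite (box_sum M (cos_term p A) (cos_term p B)) (box_sum M (theta1_term p A) (theta1_term p B)).
rewrite (box_sum M (cos_term p B) (cos_term p A)) (box_sum M (theta1_term p B) (theta1_term p A)).
rewrite !(zpartial_antisym (cos_term_antisym _ _)).
by ring.
Qed.

End Theta.

(** * The Gauss binomial theorem and finite triple products *)

Section GaussBinomial.
Local Open Scope classical_set_scope.
Local Open Scope ring_scope.
Variable K : comNzRingType.
Implicit Types (t y z : K) (M k n : nat).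

(** The Gaussian binomial coefficient with base t, by its Pascal recursion. *)
Fixpoint qbinom t M k : K :=
  match M, k with
  | _, 0%N => 1
  | 0%N, _.+1 => 0
  | M'.+1, k'.+1 => qbinom t M' k' + t ^+ k * qbinom t M' k
  end.

Lemma qbinom_small t M k : (M < k)%N -> qbinom t M k = 0.
Proof.
by elim: M k => [|M IH] [|k]//= Mk; rewrite !IH ?mulr0 ?addr0// ltnW.
Qed.

Lemma qbinom0 t M : qbinom t M 0 = 1. Proof. by case: M. Qed.

Lemma qbinom_theorem t y z M :
  \prod_(j < M) (y + z * t ^+ j) =
  \sum_(k < M.+1) t ^+ 'C(k, 2) * qbinom t M k * z ^+ k * y ^+ (M - k).
Proof.
elim: M z => [|M IH] z; first by rewrite big_ord0 big_ord1/= !mulr1.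
rewrite big_ord_recl/= expr0 mulr1.
under eq_bigr => j _ do rewrite /bump/= add1n exprS mulrA.
rewrite IH; pose a k := t ^+ 'C(k.+1, 2) * qbinom t M k.
have aE k : t ^+ 'C(k, 2) * qbinom t M k * (z * t) ^+ k = a k * z ^+ k.
  by rewrite /a binS bin1 exprD exprMn; ring.
rewrite (eq_bigr (fun k : 'I_M.+1 => a k * z ^+ k * y ^+ (M - k))); last first.
  by move=> k _; rewrite aE.
rewrite mulrDl mulr_sumr [RHS]big_ord_recl/= expr0 !mulr1 mul1r subn0.
have -> : \sum_(i < M.+1) y * (a i * z ^+ i * y ^+ (M - i)) =
  y ^+ M.+1 + \sum_(i < M.+1) t ^+ i.+1 * (t ^+ 'C(i.+1, 2) * qbinom t M i.+1) * z ^+ i.+1 * y ^+ (M - i).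
  rewrite big_ord_recl big_ord_recr/= qbinom_small// !(mulr0, mul0r) addr0.
  rewrite /a qbinom0 expr0 subn0 !mulr1 mul1r -exprS; congr (_ + _).
  apply: eq_bigr => i _; rewrite /bump/= add1n.
  have -> : (M - i = (M - i.+1).+1)%N by rewrite subnSK.
  rewrite (binS i.+1 1) bin1 exprD (exprS y (M - i.+1)).
  move: (t ^+ 'C(_, _)) (t ^+ i.+1) (z ^+ i.+1) (y ^+ _) => u1 u2 u3 u4.
  by rewrite mulrCA (mulrC u1) -(mulrA u2 u1).
rewrite -addrA; congr (_ + _); rewrite mulr_sumr -big_split/=.
apply: eq_bigr => i _; rewrite /bump/= !add1n subSS /a (exprS z); ring.
Qed.

Definition qpoch t n : K := \prod_(i < n) (1 - t ^+ i.+1).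

Lemma qpochS t n : qpoch t n.+1 = qpoch t n * (1 - t ^+ n.+1).
Proof. by rewrite /qpoch big_ord_recr. Qed.

Lemma qbinom_qpoch t M k : (k <= M)%N ->
  qbinom t M k * qpoch t k * qpoch t (M - k) = qpoch t M.
Proof.
elim: M k => [|M IH] [|k] kM//; rewrite ?qbinom0 ?subn0 /qpoch ?big_ord0 ?mul1r ?mulr1//.
rewrite -!/(qpoch _ _) subSS /= qpochS; rewrite ltnS in kM.
have h1 := IH k kM.
have h2 : qbinom t M k.+1 * qpoch t k.+1 * qpoch t (M - k) = (1 - t ^+ (M - k)) * qpoch t M.
  move: kM; rewrite leq_eqVlt => /predU1P[->|kM].
    by rewrite subnn expr0 subrr qbinom_small// !mul0r.
  rewrite -(IH _ kM); have -> : (M - k = (M - k.+1).+1)%N by rewrite subnSK.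
  by rewrite [qpoch t (_ - _).+1]qpochS; ring.
rewrite qpochS in h2; rewrite [qpoch t M.+1]qpochS.
have E : t ^+ M.+1 = t ^+ k.+1 * t ^+ (M - k) by rewrite -exprD addSn subnKC.
transitivity ((1 - t ^+ k.+1) * (qbinom t M k * qpoch t k * qpoch t (M - k)) +
  t ^+ k.+1 * (qbinom t M k.+1 * (qpoch t k * (1 - t ^+ k.+1)) * qpoch t (M - k))).
  by rewrite [t ^+ k.+1]exprS; ring.
by rewrite h1 h2 E; ring.
Qed.

End GaussBinomial.

Lemma qbinom_rmorph (K L : comNzRingType) (f : {rmorphism K -> L}) t M k :
  qbinom (f t) M k = f (qbinom t M k).
Proof.
elim: M k => [|M IH] [|k]/=; rewrite ?rmorph1 ?rmorph0//.
by rewrite rmorphD rmorphM rmorphXn !IH.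
Qed.

Section TripleProduct.
Local Open Scope classical_set_scope.
Local Open Scope ring_scope.
Variable K : fieldType.
Implicit Types (p e : K).

(** Indices are counted from the middle, in the order of [zpartial]. *)
Lemma sum_center (V : nmodType) n (F : nat -> V) :
  \sum_(k < n.+1 + n.+1) F k = \sum_(i < n.+1) (F (n - i)%N + F (n.+1 + i)%N).
Proof.
rewrite big_split_ord/= big_split/=; congr (_ + _).
rewrite (reindex_inj rev_ord_inj)/=; apply: eq_bigr => i _.
by congr F; rewrite subSS.
Qed.

Lemma prod_pow_odd p n : \prod_(l < n) p ^+ (2 * l).+1 = p ^+ (n * n).
Proof.
elim: n => [|n IH]; first by rewrite big_ord0.
by rewrite big_ord_recr/= IH -exprD; congr (_ ^+ _); nia.
Qed.

Lemma prod_pow_even p n : \prod_(l < n) p ^+ (2 * l) * p ^+ n = p ^+ (n * n).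
Proof.
elim: n => [|n IH]; first by rewrite big_ord0 mul1r.
rewrite big_ord_recr/= exprSr mulrA -(mulrA _ _ (p ^+ n)) (mulrC _ (p ^+ n)) mulrA IH.
by rewrite -exprD -exprSr; congr (_ ^+ _); nia.
Qed.

Let mul_swap (x y a b c d g : K) : a * b = c * d -> x * a * (b * g * y) = c * g * (x * y) * d.
Proof.
by move=> abcd; transitivity (a * b * (x * g * y)); [ring | rewrite abcd; ring].
Qed.

(** The Gauss binomial theorem with base p^2, recentred at its middle term:
    after the power e^n is taken out, the exponents of p form a perfect square
    and the factors pair up as conjugates when e is on the unit circle. *)
Lemma triple_product_odd p e n : p != 0 -> e != 0 ->
  \prod_(l < n) ((1 - e * p ^+ (2 * l).+1) * (1 - e^-1 * p ^+ (2 * l).+1)) =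
  \sum_(i < n.+1) (p ^+ (i * i) * qbinom (p ^+ 2) (2 * n) (n - i) * (- e^-1) ^+ i +
     p ^+ (i.+1 * i.+1) * qbinom (p ^+ 2) (2 * n) (n.+1 + i) * (- e) ^+ i.+1).
Proof.
move=> p0 e0; have e0' : - e != 0 by rewrite oppr_eq0.
have pn0 m : p ^+ m != 0 by rewrite expf_neq0.
(* The factor produced by writing the binomial product in homogeneous form,
   with p^(2n) as second variable, so that no negative power of p occurs. *)
apply: (mulfI (mulf_neq0 (expf_neq0 n e0') (pn0 (3 * (n * n))%N))).
set L := LHS; set RR := RHS.
have : \prod_(j < n + n) (p ^+ (2 * n) + (- e * p) * (p ^+ 2) ^+ j) = L.
  rewrite big_split_ord/= (reindex_inj rev_ord_inj)/= /L.
  rewrite (eq_bigr (fun l : 'I_n => (- e * p ^+ (2 * (n - l.+1)).+1) * (1 - e^-1 * p ^+ (2 * l).+1))); last first.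
    move=> l _; have -> : p ^+ (2 * n) = p ^+ (2 * (n - l.+1)).+1 * p ^+ (2 * l).+1.
      by rewrite -exprD; congr (_ ^+ _); have := ltn_ord l; lia.
    by rewrite -exprM exprS; field.
  rewrite big_split/=.
  have -> : \prod_(i < n) (- e * p ^+ (2 * (n - i.+1)).+1) = (- e) ^+ n * p ^+ (n * n).
    rewrite big_split/= prodr_const card_ord -prod_pow_odd; congr (_ * _).
    by rewrite [RHS](reindex_inj rev_ord_inj).
  have -> : \prod_(i < n) (p ^+ (2 * n) + - e * p * (p ^+ 2) ^+ (n + i)) =
      p ^+ (2 * (n * n)) * \prod_(i < n) (1 - e * p ^+ (2 * i).+1).
    rewrite (eq_bigr (fun i : 'I_n => p ^+ (2 * n) * (1 - e * p ^+ (2 * i).+1))); last first.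
      by move=> i _; rewrite -exprM mulnDr exprD exprS; ring.
    by rewrite big_split/= prodr_const card_ord -exprM mulnA.
  rewrite big_split/= (_ : 3 * (n * n) = n * n + 2 * (n * n))%N; last by lia.
  by rewrite exprD; ring.
move=> <-; rewrite qbinom_theorem.
pose F k := (p ^+ 2) ^+ 'C(k, 2) * qbinom (p ^+ 2) (n + n) k * (- e * p) ^+ k *
  (p ^+ (2 * n)) ^+ (n + n - k).
have -> : \sum_(k < (n + n).+1) F k = \sum_(k < n.+1 + n.+1) F k.
  have F0 : F (n + n).+1 = 0 by rewrite /F qbinom_small// mulr0 !mul0r.
  have -> : (n.+1 + n.+1 = (n + n).+2)%N by lia.
  by rewrite [RHS]big_ord_recr/= F0 addr0.
have F2 k : (p ^+ 2) ^+ 'C(k, 2) * p ^+ k = p ^+ (k * k).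
  rewrite -exprM -exprD; congr (_ ^+ _); elim: k => // k IH.
  by rewrite binS bin1; nia.
have FE k : F k = p ^+ (k * k) * qbinom (p ^+ 2) (n + n) k * (- e) ^+ k * p ^+ (2 * n * (n + n - k)).
  rewrite -(F2 k) /F (exprMn _ (- e)) (exprM p (2 * n)).
  move: ((p ^+ 2) ^+ _) ((p ^+ (2 * n)) ^+ _) (p ^+ k) => u1 u2 u3; ring.
rewrite sum_center /RR mulr_sumr; apply: eq_bigr => i _.
have : (i <= n)%N by rewrite -ltnS.
move: (nat_of_ord i) => {}i iin.
rewrite mulrDr !FE mul2n -addnn; congr (_ + _).
  have E1 : (- e) ^+ (n - i) = (- e) ^+ n * (- e^-1) ^+ i.
    by rewrite -[in RHS](subnK iin) exprD -mulrA -exprMn mulrNN mulfV// expr1n mulr1.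
  have E2 : p ^+ ((n - i) * (n - i)) * p ^+ ((n + n) * (n + n - (n - i))) =
      p ^+ (3 * (n * n)) * p ^+ (i * i).
    by rewrite -!exprD; congr (_ ^+ _); nia.
  by rewrite E1; apply: esym; exact: mul_swap (esym E2).
have E1 : (- e) ^+ (n.+1 + i) = (- e) ^+ n * (- e) ^+ i.+1.
  by rewrite -exprD addSnnS.
have [iltn|] := ltnP i n; last first.
  move=> nlei; rewrite qbinom_small; last by rewrite addSn ltnS leq_add2l.
  by rewrite !(mulr0, mul0r).
have E2 : p ^+ ((n.+1 + i) * (n.+1 + i)) * p ^+ ((n + n) * (n + n - (n.+1 + i))) =
      p ^+ (3 * (n * n)) * p ^+ (i.+1 * i.+1).
    by rewrite -!exprD; congr (_ ^+ _); nia.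
by rewrite E1; apply: esym; exact: mul_swap (esym E2).
Qed.

(** The same with an odd number of factors; the unpaired middle one is 1 - e. *)
Lemma triple_product_even p e n : p != 0 -> e != 0 ->
  (1 - e) * \prod_(l < n) ((1 - e * p ^+ (2 * l.+1)) * (1 - e^-1 * p ^+ (2 * l.+1))) =
  \sum_(i < n.+1) (p ^+ (i * i + i) * qbinom (p ^+ 2) (2 * n).+1 (n - i) * (- e^-1) ^+ i +
     p ^+ (i * i + i) * qbinom (p ^+ 2) (2 * n).+1 (n.+1 + i) * (- e) ^+ i.+1).
Proof.
move=> p0 e0; have e0' : - e != 0 by rewrite oppr_eq0.
have pn0 m : p ^+ m != 0 by rewrite expf_neq0.
apply: (mulfI (mulf_neq0 (expf_neq0 n e0') (pn0 (3 * (n * n) + n)%N))).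
set L := LHS; set RR := RHS.
have : \prod_(j < n + n.+1) (p ^+ (2 * n) + (- e) * (p ^+ 2) ^+ j) = L.
  rewrite big_split_ord/= (reindex_inj rev_ord_inj)/=.
  rewrite (eq_bigr (fun l : 'I_n => (- e * p ^+ (2 * (n - l.+1))) * (1 - e^-1 * p ^+ (2 * l.+1)))); last first.
    move=> l _; have -> : p ^+ (2 * n) = p ^+ (2 * (n - l.+1)) * p ^+ (2 * l.+1).
      by rewrite -exprD; congr (_ ^+ _); have := ltn_ord l; lia.
    by rewrite -exprM; field.
  rewrite big_split/=.
  set Q := \prod_(i < n) (- e * p ^+ (2 * (n - i.+1))).
  have QE : Q * p ^+ n = (- e) ^+ n * p ^+ (n * n).
    rewrite /Q big_split/= prodr_const card_ord -prod_pow_even -mulrA; congr (_ * (_ * _)).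
    by rewrite [RHS](reindex_inj rev_ord_inj).
  have -> : \prod_(i < n.+1) (p ^+ (2 * n) + - e * (p ^+ 2) ^+ (n + i)) =
      p ^+ (2 * (n * n) + n) * p ^+ n * ((1 - e) * \prod_(i < n) (1 - e * p ^+ (2 * i.+1))).
    rewrite (eq_bigr (fun i : 'I_n.+1 => p ^+ (2 * n) * (1 - e * p ^+ (2 * i)))); last first.
      by move=> i _; rewrite -exprM mulnDr (exprD _ (2 * n)) mulrBr mulr1 mulNr mulrCA.
    rewrite big_split/= prodr_const card_ord -exprM -exprD [in LHS]big_ord_recl/= expr0 mulr1.
    by congr (_ * _); congr (_ ^+ _); lia.
  rewrite /L big_split/= (_ : 3 * (n * n) + n = n * n + (2 * (n * n) + n))%N; last by lia.
  rewrite [p ^+ (n * n + _)]exprD.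
  set P1 := \prod_(i < n) (1 - e * p ^+ (2 * i.+1)).
  set P2 := \prod_(i < n) (1 - e^-1 * p ^+ (2 * i.+1)).
  rewrite (mulrA _ (p ^+ (n * n))) -QE.
  by move: (p ^+ n) (p ^+ _) => c d; ring.
move=> <-; rewrite qbinom_theorem.
have -> : (n + n.+1 = (2 * n).+1)%N by lia.
set N := (2 * n).+1.
pose F k := (p ^+ 2) ^+ 'C(k, 2) * qbinom (p ^+ 2) N k * (- e) ^+ k *
  (p ^+ (2 * n)) ^+ (N - k).
have -> : \sum_(k < N.+1) F k = \sum_(k < n.+1 + n.+1) F k.
  by have -> : (n.+1 + n.+1 = N.+1)%N by rewrite /N; lia.
have F2 k : (p ^+ 2) ^+ 'C(k, 2) * p ^+ k = p ^+ (k * k).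
  rewrite -exprM -exprD; congr (_ ^+ _); elim: k => // k IH.
  by rewrite binS bin1; nia.
rewrite sum_center /RR mulr_sumr; apply: eq_bigr => i _.
have : (i <= n)%N by rewrite -ltnS.
move: (nat_of_ord i) => {}i iin.
have FE k j : (k <= N)%N -> (j * j + j + 2 * n * k + k = k * k + n * n + n)%N ->
    F k = p ^+ (3 * (n * n) + n) * p ^+ (j * j + j) * qbinom (p ^+ 2) N k * (- e) ^+ k.
  move=> kN jk.
  have E2 : (p ^+ 2) ^+ 'C(k, 2) * (p ^+ (2 * n)) ^+ (N - k) =
      p ^+ (3 * (n * n) + n) * p ^+ (j * j + j).
    apply: (mulIf (pn0 k)); rewrite mulrAC F2 -exprM -!exprD; congr (_ ^+ _).
    by move: kN; rewrite /N; nia.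
  by rewrite /F mulrAC (mulrAC _ _ (_ ^+ (N - k))) E2.
rewrite mulrDr; congr (_ + _).
  rewrite (@FE (n - i)%N i) /N; [|by lia|by nia].
  have -> : (- e) ^+ (n - i) = (- e) ^+ n * (- e^-1) ^+ i.
    by rewrite -[in RHS](subnK iin) exprD -mulrA -exprMn mulrNN mulfV// expr1n mulr1.
  by move: (qbinom _ _ _) ((- e) ^+ n) (p ^+ _) (p ^+ _) (_ ^+ i) => *; ring.
rewrite (@FE (n.+1 + i)%N i) /N; [|by lia|by nia].
rewrite (_ : (- e) ^+ (n.+1 + i) = (- e) ^+ n * (- e) ^+ i.+1); last by rewrite -exprD addSnnS.
by move: (qbinom _ _ _) ((- e) ^+ n) (p ^+ _) (p ^+ _) (_ ^+ i.+1) => *; ring.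
Qed.

End TripleProduct.

(** * Trigonometric form of the finite products *)

Section Cis.
Local Open Scope classical_set_scope.
Local Open Scope ring_scope.
Variable R : realType.
Local Notation C := R[i].
Local Open Scope complex_scope.
Implicit Types (x y p v : R).

(** The point of the unit circle with argument x. *)
Definition cis x : C := cos x +i* sin x.

Lemma cisD x y : cis (x + y) = cis x * cis y.
Proof.
by apply/eqP; rewrite eq_complex/= cosD sinD eqxx addrC eqxx.
Qed.

Lemma cis0 : cis 0 = 1.
Proof. by apply/eqP; rewrite eq_complex/= cos0 sin0 !eqxx. Qed.

Lemma cisK x : cis x * cis (- x) = 1.
Proof. by rewrite -cisD subrr cis0. Qed.

Lemma cis_neq0 x : cis x != 0.
Proof.
by apply/negP => /eqP h; have := cisK x; rewrite h mul0r => /esym/eqP; rewrite oner_eq0.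
Qed.

Lemma cisV x : (cis x)^-1 = cis (- x).
Proof. by apply: mulr1_eq; rewrite cisK. Qed.

Lemma cisX x n : cis x ^+ n = cis (n%:R * x).
Proof.
elim: n => [|n IH]; first by rewrite mul0r cis0.
by rewrite exprS IH -cisD -natr1 mulrDl mul1r addrC.
Qed.

Lemma Re_sum (I : Type) (r : seq I) (P : pred I) (F : I -> C) :
  complex.Re (\sum_(i <- r | P i) F i) = \sum_(i <- r | P i) complex.Re (F i).
Proof. by apply: (big_morph (@complex.Re R)) => // -[a b] [c d]. Qed.

Lemma Re_add (a b : C) : complex.Re (a + b) = complex.Re a + complex.Re b.
Proof. by case: a b => [? ?] [? ?]. Qed.

Lemma ReM_real (a : R) (z : C) : complex.Re (a%:C * z) = a * complex.Re z.
Proof. by case: z => c d; rewrite /= mul0r subr0. Qed.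

(** The squared modulus of 1 - v e^(i x). *)
Definition theta_factor v x : R := 1 - 2 * v * cos x + v ^+ 2.

Lemma theta_factorE v x : (theta_factor v x)%:C = (1 - cis x * v%:C) * (1 - (cis x)^-1 * v%:C).
Proof.
apply/eqP; rewrite cisV eq_complex/= cosN sinN; apply/andP; split; apply/eqP; last by ring.
transitivity (1 - 2 * v * cos x + v ^+ 2 * (cos x ^+ 2 + sin x ^+ 2)).
  by rewrite cos2Dsin2 mulr1.
ring.
Qed.

Definition theta3_prod p n x : R := \prod_(l < n) theta_factor (p ^+ (2 * l).+1) x.
Definition theta1_prod p n x : R := \prod_(l < n) theta_factor (p ^+ (2 * l.+1)) x.

Lemma real_neq0 p : p != 0 -> p%:C != 0 :> C.
Proof. by move=> p0; rewrite (inj_eq (@complexI R) p 0). Qed.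

Lemma rC_exp p n : (p ^+ n)%:C = p%:C ^+ n :> C. Proof. exact: rmorphXn. Qed.

Lemma rCM (a b : R) : (a * b)%:C = a%:C * b%:C :> C. Proof. exact: rmorphM. Qed.

Lemma qbinomC p M k : qbinom (p%:C ^+ 2) M k = (qbinom (p ^+ 2) M k)%:C.
Proof. by rewrite -rC_exp qbinom_rmorph. Qed.

Lemma NcisX x i : (- cis x) ^+ i = ((-1) ^+ i)%:C * cis (i%:R * x).
Proof. by rewrite (exprNn (cis x)) cisX rmorphXn rmorphN1. Qed.

Lemma theta3_prod_expand p n x : p != 0 ->
  theta3_prod p n x = \sum_(i < n.+1)
   (qbinom (p ^+ 2) (2 * n) (n - i) * theta3_term p (x + pi) (Posz i) +
    qbinom (p ^+ 2) (2 * n) (n.+1 + i) * theta3_term p (x + pi) (Negz i)).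
Proof.
move=> p0.
have : \prod_(l < n) ((1 - cis x * p%:C ^+ (2 * l).+1) *
  (1 - (cis x)^-1 * p%:C ^+ (2 * l).+1)) = (theta3_prod p n x)%:C.
  by rewrite rmorph_prod; apply: eq_bigr => l _; rewrite -rC_exp -theta_factorE.
rewrite triple_product_odd ?real_neq0 ?cis_neq0// => E.
have /(congr1 (@complex.Re R)) := E => /= <-.
rewrite Re_sum; apply: eq_bigr => i _.
rewrite cisV !qbinomC !NcisX -!rC_exp.
set g1 := qbinom _ _ _; set g2 := qbinom _ _ _.
rewrite !theta3_term_pi /theta3_term sqz_Posz sqz_Negz Re_add !mulrA -!rCM !ReM_real /=.
rewrite mulrN cosN NegzE signzN mulrNz mulNr cosN -!pmulrn -!exprnP; ring.
Qed.

Lemma theta1_prod_expand p n x : p != 0 ->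
  2 * sin (x / 2) * theta1_prod p n x = \sum_(i < n.+1)
   (qbinom (p ^+ 2) (2 * n).+1 (n - i) * theta1_term p x (Posz i) +
    qbinom (p ^+ 2) (2 * n).+1 (n.+1 + i) * theta1_term p x (Negz i)).
Proof.
move=> p0.
have E : (1 - cis x) * (theta1_prod p n x)%:C = \sum_(i < n.+1)
  ((p ^+ (i * i + i) * qbinom (p ^+ 2) (2 * n).+1 (n - i) * (-1) ^+ i)%:C * cis (- (i%:R * x)) +
   (p ^+ (i * i + i) * qbinom (p ^+ 2) (2 * n).+1 (n.+1 + i) * (-1) ^+ i.+1)%:C * cis (i.+1%:R * x)).
  have -> : (theta1_prod p n x)%:C = \prod_(l < n) ((1 - cis x * p%:C ^+ (2 * l.+1)) *
      (1 - (cis x)^-1 * p%:C ^+ (2 * l.+1))).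
    by rewrite rmorph_prod; apply: eq_bigr => l _; rewrite -rC_exp -theta_factorE.
  rewrite triple_product_even ?real_neq0 ?cis_neq0//; apply: eq_bigr => i _.
  by rewrite cisV !qbinomC !NcisX -!rC_exp !rmorphM/= mulrN !mulrA.
(* Rotating by half the angle makes the unpaired factor real. *)
have h : 1 - cis x = (2 * sin (x / 2))%:C * ((- 'i) * cis (x / 2)).
  apply/eqP; rewrite eq_complex/=.
  have -> : cos x = 1 - 2 * sin (x / 2) ^+ 2.
    by rewrite {1}(splitr x) cosD -[X in X - _]expr2 cos2sin2; ring.
  have -> : sin x = 2 * sin (x / 2) * cos (x / 2).
    by rewrite {1}(splitr x) sinD; ring.
  by apply/andP; split; apply/eqP; ring.
have {}E : (2 * sin (x / 2) * theta1_prod p n x)%:C = \sum_(i < n.+1)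
  ((p ^+ (i * i + i) * qbinom (p ^+ 2) (2 * n).+1 (n - i) * (-1) ^+ i)%:C * ('i * cis (- ((i%:R + 2^-1) * x))) +
   (p ^+ (i * i + i) * qbinom (p ^+ 2) (2 * n).+1 (n.+1 + i) * (-1) ^+ i.+1)%:C * ('i * cis ((i%:R + 2^-1) * x))).
  transitivity ('i * cis (- (x / 2)) * ((1 - cis x) * (theta1_prod p n x)%:C)).
    rewrite h rmorphM/=; transitivity ((2 * sin (x / 2))%:C * (theta1_prod p n x)%:C * (- ('i * 'i)) * (cis (x / 2) * cis (- (x / 2)))).
      by rewrite cisK -expr2 sqr_i opprK !mulr1.
    by ring.
  rewrite E mulr_sumr; apply: eq_bigr => i _.
  rewrite mulrDr ![_ * (_%:C * _)]mulrCA -!mulrA -!cisD.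
  congr (_ * (_ * cis _) + _ * (_ * cis _)); first by field.
  by rewrite -natr1; field.
have /(congr1 (@complex.Re R)) := E => /= ->.
rewrite Re_sum; apply: eq_bigr => i _.
rewrite /theta1_term sqzD_Posz sqzD_Negz Re_add !ReM_real.
have -> : ((Negz i)%:~R + 2^-1) * x = - ((i%:R + 2^-1) * x) :> R.
  by rewrite NegzE mulrNz -pmulrn -natr1; field.
rewrite sinN NegzE signzN -!pmulrn -!exprnP exprS /= !mul0r !mul1r !sub0r sinN opprK; ring.
Qed.

End Cis.

(** * Jacobi product formulas *)

Section ProductFormula.
Local Open Scope classical_set_scope.
Local Open Scope ring_scope.
Variable R : realType.
Implicit Types (t p x : R).

(** A positive lower bound for all products of the 1 - t^i, obtained from
    1 - u >= exp (- u / (1 - u)). *)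
Definition qpoch_lb t : R := expR (- (1 - t)^-1 ^+ 2).

Lemma qpoch_lb_gt0 t : 0 < qpoch_lb t. Proof. exact: expR_gt0. Qed.

Lemma qpoch_ge t n : 0 < t < 1 -> qpoch_lb t <= qpoch t n.
Proof.
move=> /andP[t0 t1]; have t1' : 0 < 1 - t by rewrite subr_gt0.
apply: (@le_trans _ _ (expR (- \sum_(i < n) (1 - t)^-1 * t ^+ i))).
  rewrite ler_expR lerN2 expr2; apply: geo_sum_le; rewrite ?invr_ge0 ?(ltW t1')//.
  by rewrite (ltW t0).
rewrite -sumrN expR_sum; apply: ler_prod => i _; rewrite expR_ge0/=.
have u1 : t ^+ i.+1 < 1 by rewrite exprn_ilt1// ltW.
have u0 : 0 < t ^+ i by rewrite exprn_gt0.
rewrite expRN -[leRHS]invrK lef_pV2 ?posrE ?expR_gt0 ?invr_gt0 ?subr_gt0//.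
apply: le_trans (expR_ge1Dx _).
rewrite -[leLHS]mul1r ler_pdivrMr ?subr_gt0// mulrDl mul1r exprS.
have a0 : 0 < (1 - t)^-1 by rewrite invr_gt0.
have -> : t * t ^+ i = t ^+ i - (1 - t) * t ^+ i by ring.
set v := t ^+ i in u0 *; set a := (1 - t)^-1 in a0 *.
have at1 : a * (1 - t) = 1 by rewrite mulVf// gt_eqF.
have v1 : v <= 1 by rewrite exprn_ile1// ltW.
have -> : 1 - (v - (1 - t) * v) + a * v * (1 - (v - (1 - t) * v)) =
  1 - v + (1 - t) * v + a * v * (1 - v) + (a * (1 - t)) * v ^+ 2 by ring.
rewrite at1 mul1r.
have : 0 <= a * v * (1 - v) - (1 - v) * v.
  rewrite -mulrA [(1 - v) * v]mulrC -[X in _ - X]mul1r -mulrBl mulr_ge0//.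
    by rewrite subr_ge0 invf_ge1// lerBlDr lerDl ltW.
  by rewrite mulr_ge0 ?subr_ge0// ltW.
have : 0 <= (1 - t) * v by rewrite mulr_ge0// ltW.
rewrite expr2; nra.
Qed.

Lemma qpoch_gt0 t n : 0 < t < 1 -> 0 < qpoch t n.
Proof. by move=> t01; exact: lt_le_trans (qpoch_lb_gt0 t) (qpoch_ge n t01). Qed.

Lemma qpoch_le1 t n : 0 < t < 1 -> qpoch t n <= 1.
Proof.
move=> /andP[t0 t1]; apply: prodr_ile1 => i _.
by rewrite subr_ge0 exprn_ile1 ?(ltW t0) ?(ltW t1)//= gerBl exprn_ge0 ?(ltW t0).
Qed.

Definition qpoch_inf t : R := limn (qpoch t).

Lemma qpoch_cvg t : 0 < t < 1 -> qpoch t n @[n --> \oo] --> qpoch_inf t.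
Proof.
move=> t01; have [t0 t1] := andP t01; apply: nonincreasing_is_cvgn.
  apply/nonincreasing_seqP => n; rewrite qpochS ler_piMr ?(ltW (qpoch_gt0 _ _))//.
  by rewrite gerBl exprn_ge0// ltW.
by exists 0 => _ [n _ <-]; exact: ltW (qpoch_gt0 _ _).
Qed.

Lemma qpoch_inf_gt0 t : 0 < t < 1 -> 0 < qpoch_inf t.
Proof.
move=> t01; apply: lt_le_trans (qpoch_lb_gt0 t) _.
by apply: (cvg_ge_near (qpoch_cvg t01)); near=> n; exact: qpoch_ge.
Unshelve. all: end_near. Qed.

Lemma qbinomE t M k : 0 < t < 1 -> (k <= M)%N ->
  qbinom t M k = qpoch t M / (qpoch t k * qpoch t (M - k)).
Proof.
move=> t01 kM; rewrite -(qbinom_qpoch t kM) -(mulrA (qbinom t M k)) mulfK//.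
by rewrite mulf_neq0// gt_eqF// qpoch_gt0.
Qed.

Lemma qbinom_bound t M k : 0 < t < 1 -> `|qbinom t M k| <= (qpoch_lb t) ^- 2.
Proof.
move=> t01; have [kM|kM] := leqP k M; last first.
  by rewrite qbinom_small// normr0 invr_ge0 exprn_ge0 ?(ltW (qpoch_lb_gt0 t)).
have pp : 0 < qpoch t k * qpoch t (M - k) by rewrite mulr_gt0 ?qpoch_gt0.
rewrite qbinomE// ger0_norm ?divr_ge0 ?(ltW pp) ?(ltW (qpoch_gt0 _ _))//.
rewrite ler_pdivrMr// (le_trans (qpoch_le1 _ t01))// mulrC ler_pdivlMr ?exprn_gt0 ?qpoch_lb_gt0//.
by rewrite mul1r expr2 ler_pM ?(ltW (qpoch_lb_gt0 t)) ?qpoch_ge.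
Qed.

Lemma qbinom_cvg t (M k : nat -> nat) : 0 < t < 1 ->
  (\forall n \near \oo, (k n <= M n)%N) -> k n @[n --> \oo] --> \oo ->
  (M n - k n)%N @[n --> \oo] --> \oo ->
  qbinom t (M n) (k n) @[n --> \oo] --> (qpoch_inf t)^-1.
Proof.
move=> t01 kM koo Mkoo; have C0 := qpoch_inf_gt0 t01.
have Moo : M n @[n --> \oo] --> \oo.
  apply/cvgnyPge => A; have /cvgnyPge/(_ A) := koo; apply: filterS2 kM => n.
  by move=> h1 h2; exact: leq_trans h2 h1.
have E : (qpoch_inf t)^-1 = qpoch_inf t / (qpoch_inf t * qpoch_inf t).
  by rewrite invfM mulrA mulfV ?mul1r// gt_eqF.
have : qpoch t (M n) / (qpoch t (k n) * qpoch t (M n - k n)) @[n --> \oo] --> (qpoch_inf t)^-1.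
  rewrite E; apply: cvgM; first exact: (cvg_comp _ _ Moo (qpoch_cvg t01)).
  apply: cvgV; first by rewrite mulf_neq0 ?gt_eqF.
  apply: cvgM; first exact: (cvg_comp _ _ koo (qpoch_cvg t01)).
  exact: (cvg_comp _ _ Mkoo (qpoch_cvg t01)).
apply: cvg_trans; apply: near_eq_cvg; near=> n.
by rewrite qbinomE//; near: n.
Unshelve. all: end_near. Qed.

(** Away from their ends, the rows of large Gaussian binomial coefficients
    approach the constant 1 / qpoch_inf t; Tannery's theorem applies since the
    coefficients are bounded. *)
Lemma qbinom_sum_cvg t (f : int -> R) c r (d : nat) : 0 < t < 1 -> 0 <= r < 1 -> zdom c r f ->
  \sum_(i < n.+1) (qbinom t (2 * n + d) (n - i) * f (Posz i) +
                   qbinom t (2 * n + d) (n.+1 + i) * f (Negz i)) @[n --> \oo] -->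
  (qpoch_inf t)^-1 * zsum f.
Proof.
move=> t01 r01 fd.
pose a n i := if (i <= n)%N then qbinom t (2 * n + d) (n - i) * f (Posz i) +
                   qbinom t (2 * n + d) (n.+1 + i) * f (Negz i) else 0.
have aE n : \sum_(i < n.+1) (qbinom t (2 * n + d) (n - i) * f (Posz i) +
                   qbinom t (2 * n + d) (n.+1 + i) * f (Negz i)) = series_lim (a n).
  rewrite (@series_lim_finite R _ n.+1) => [|i ni].
    by apply: eq_bigr => i _; rewrite /a -ltnS ltn_ord.
  by rewrite /a leqNgt ni.
under eq_cvg do rewrite aE.
pose b i := (qpoch_inf t)^-1 * (f (Posz i) + f (Negz i)).
have <- : series_lim b = (qpoch_inf t)^-1 * zsum f.
  apply: cvg_lim => //; rewrite (_ : series b = fun n => (qpoch_inf t)^-1 * zpartial n f).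
    by apply: cvgM; [exact: cvg_cst|exact: zpartial_cvg r01 fd].
  by apply/funext => n; rewrite /series/= big_mkord -mulr_sumr.
pose c' := 2 * ((qpoch_lb t) ^- 2 * c).
have c0 : 0 <= c by have [/(le_trans (normr_ge0 _)) + _] := fd 0%N; rewrite mulr1.
apply: (tannery (c := c') r01).
  near=> n => i; rewrite /a; case: ifP => _; last first.
    rewrite normr0 mulr_ge0 ?exprn_ge0//; last by case/andP: r01.
    by rewrite /c' !mulr_ge0// invr_ge0 exprn_ge0 ?(ltW (qpoch_lb_gt0 t)).
  have [f1 f2] := fd i.
  apply: (le_trans (ler_normD _ _)); rewrite !normrM /c' -mulrA mulr_natl mulr2n -mulrA.
  by apply: lerD; apply: ler_pM => //; exact: qbinom_bound.
move=> i; rewrite /b mulrDr.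
have : qbinom t (2 * n + d) (n - i) * f (Posz i) +
  qbinom t (2 * n + d) (n.+1 + i) * f (Negz i) @[n --> \oo] -->
  (qpoch_inf t)^-1 * f (Posz i) + (qpoch_inf t)^-1 * f (Negz i).
  apply: cvgD; apply: cvgM; try exact: cvg_cst; apply: qbinom_cvg => //.
  - by near=> n; lia.
  - apply/cvgnyPge => A; near=> n.
    have : (A + i <= n)%N by near: n; exact: nbhs_infty_ge.
    lia.
  - apply/cvgnyPge => A; near=> n.
    have : (A + i <= n)%N by near: n; exact: nbhs_infty_ge.
    lia.
  - near=> n; have : (i.+1 <= n)%N by near: n; exact: nbhs_infty_ge.
    lia.
  - apply/cvgnyPge => A; near=> n.
    have : (A + i <= n)%N by near: n; exact: nbhs_infty_ge.
    lia.
  - apply/cvgnyPge => A; near=> n.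
    have : (A + i.+1 <= n)%N by near: n; exact: nbhs_infty_ge.
    lia.
apply: cvg_trans; apply: near_eq_cvg; near=> n.
by rewrite /a ifT//; near: n; exact: nbhs_infty_ge.
Unshelve. all: end_near. Qed.

Lemma theta3_prod_cvg p x : 0 < p < 1 ->
  theta3_prod p n x @[n --> \oo] --> (qpoch_inf (p ^+ 2))^-1 * theta3 p (x + pi).
Proof.
move=> p01; have [p0 p1] := andP p01.
have t01 : 0 < p ^+ 2 < 1 by rewrite exprn_gt0// expr_lte1// ltW.
have r01 : 0 <= p < 1 by rewrite ltW.
have := @qbinom_sum_cvg (p ^+ 2) _ _ _ 0 t01 r01 (theta3_term_dom (x + pi) p01).
apply: cvg_trans; apply: near_eq_cvg; near=> n.
by rewrite theta3_prod_expand ?gt_eqF// addn0.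
Unshelve. all: end_near. Qed.

Lemma theta1_prod_cvg p x : 0 < p < 1 ->
  2 * sin (x / 2) * theta1_prod p n x @[n --> \oo] --> (qpoch_inf (p ^+ 2))^-1 * theta1 p x.
Proof.
move=> p01; have [p0 p1] := andP p01.
have t01 : 0 < p ^+ 2 < 1 by rewrite exprn_gt0// expr_lte1// ltW.
have r01 : 0 <= p < 1 by rewrite ltW.
have := @qbinom_sum_cvg (p ^+ 2) _ _ _ 1 t01 r01 (theta1_term_dom x p01).
apply: cvg_trans; apply: near_eq_cvg; near=> n.
by rewrite theta1_prod_expand ?gt_eqF// addn1.
Unshelve. all: end_near. Qed.

Lemma theta_factor_ge v x : 0 <= v -> (1 - v) ^+ 2 <= theta_factor v x.
Proof.
by move=> v0; rewrite /theta_factor; have := ler_wpM2l v0 (cos_le1 x); lra.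
Qed.

Lemma theta3_prod_ge p n x : 0 < p < 1 -> (qpoch_lb p) ^+ 2 <= theta3_prod p n x.
Proof.
move=> p01; have [p0 p1] := andP p01.
apply: (@le_trans _ _ ((qpoch p n) ^+ 2)).
  by rewrite lerXn2r ?nnegrE ?(ltW (qpoch_lb_gt0 p)) ?(ltW (qpoch_gt0 _ _)) ?qpoch_ge.
rewrite /qpoch -prodrXl; apply: ler_prod => i _; rewrite sqr_ge0/=.
apply: le_trans (theta_factor_ge _ _); last by rewrite exprn_ge0// ltW.
have h : p ^+ (2 * i).+1 <= p ^+ i.+1.
  by apply: (ler_wiXn2l (ltW p0) (ltW p1)); lia.
have h1 : p ^+ i.+1 <= 1 by rewrite exprn_ile1// ltW.
rewrite lerXn2r ?nnegrE ?subr_ge0 ?(le_trans h)//.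
by rewrite lerD2l lerN2.
Qed.

(** Positivity is not visible on the series, where the terms alternate near
    x = pi, but each factor of the product is positive. *)
Lemma theta3_gt0 p x : 0 < p < 1 -> 0 < theta3 p x.
Proof.
move=> p01; have [p0 p1] := andP p01.
have t01 : 0 < p ^+ 2 < 1 by rewrite exprn_gt0// expr_lte1// ltW.
have := theta3_prod_cvg (x := x - pi) p01; rewrite subrK => cv.
have : 0 < (qpoch_inf (p ^+ 2))^-1 * theta3 p x.
  apply: (@lt_le_trans _ _ ((qpoch_lb p) ^+ 2)); first by rewrite exprn_gt0 ?qpoch_lb_gt0.
  by apply: (cvg_ge_near cv); near=> n; exact: theta3_prod_ge.
by rewrite pmulr_rgt0// invr_gt0 qpoch_inf_gt0.
Unshelve. all: end_near. Qed.

(** Each factor of the product is increasing in cos x. *)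
Lemma theta3_ge p x y : 0 < p < 1 -> cos y <= cos x -> theta3 p y <= theta3 p x.
Proof.
move=> p01 yx; have [p0 p1] := andP p01.
have t01 : 0 < p ^+ 2 < 1 by rewrite exprn_gt0// expr_lte1// ltW.
have := theta3_prod_cvg (x := y - pi) p01; have := theta3_prod_cvg (x := x - pi) p01.
rewrite !subrK => cx cy; have C0 := qpoch_inf_gt0 t01.
rewrite -(@ler_pM2l _ (qpoch_inf (p ^+ 2))^-1) ?invr_gt0// -subr_ge0.
apply: (cvg_ge_near (cvgB cx cy)); near=> n; rewrite subr_ge0.
apply: ler_prod => i _; apply/andP; split.
  by apply: le_trans (theta_factor_ge _ _); rewrite ?sqr_ge0 ?exprn_ge0// ltW.
have v0 : 0 <= p ^+ (2 * i).+1 by rewrite exprn_ge0// ltW.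
rewrite /theta_factor lerD2r lerD2l lerN2 ler_wpM2l ?mulr_ge0//.
have cpi z : cos (z - pi) = - cos z by rewrite -[in RHS](subrK pi z) cosDpi opprK.
by rewrite !cpi lerN2.
Unshelve. all: end_near. Qed.

Lemma theta3_pi_le1 p : 0 < p < 1 -> theta3 p pi <= 1.
Proof.
move=> p01; have [p0 p1] := andP p01.
have t01 : 0 < p ^+ 2 < 1 by rewrite exprn_gt0// expr_lte1// ltW.
have := theta3_prod_cvg (x := 0) p01; rewrite add0r => cv.
have C0 := qpoch_inf_gt0 t01.
apply: (@le_trans _ _ (qpoch_inf (p ^+ 2))).
  rewrite -[leRHS]mulr1 -ler_pdivrMl//.
  apply: (cvg_le_near cv); near=> n; apply: prodr_ile1 => i _.
  have v0 : 0 <= p ^+ (2 * i).+1 by rewrite exprn_ge0// ltW.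
  have v1 : p ^+ (2 * i).+1 <= 1 by rewrite exprn_ile1// ltW.
  rewrite (le_trans _ (theta_factor_ge _ v0)) ?sqr_ge0//= /theta_factor cos0 mulr1.
  rewrite expr2; nra.
by apply: (cvg_le_near (qpoch_cvg t01)); near=> n; exact: qpoch_le1.
Unshelve. all: end_near. Qed.

End ProductFormula.

(** * Subdivision of the period *)

Section RootsOfUnity.
Local Open Scope classical_set_scope.
Local Open Scope ring_scope.
Variable R : realType.
Local Notation C := R[i].
Local Open Scope complex_scope.
Implicit Types (x v : R).

Lemma cos_neq1 x : 0 < x < 2 * pi -> cos x != 1.
Proof.
move=> /andP[x0 x2]; rewrite {1}(splitr x) cosD -[X in X - _]expr2 cos2sin2.
have s0 : 0 < sin (x / 2) by apply: sin_gt0_pi; apply/andP; split; lra.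
apply/eqP; have := mulr_gt0 s0 s0; rewrite expr2; lra.
Qed.

Lemma cis_2pi : cis (2 * pi) = 1 :> C.
Proof.
by rewrite /cis mulr_natl cos2pi sin2pi.
Qed.

Lemma cis_primitive n : (0 < n)%N -> n.-primitive_root (cis (2 * pi / n%:R) : C).
Proof.
move=> n0; apply/andP; split => //; apply/forallP => i; apply/eqP.
rewrite unity_rootE cisX; apply/idP/idP; last first.
  by move=> /eqP ->; rewrite mulrCA divff ?mulr1 ?cis_2pi// pnatr_eq0 -lt0n.
apply: contraTT => /eqP in'.
have lti : (i.+1 < n)%N by have := ltn_ord i; lia.
rewrite eq_complex/= negb_and; apply/orP; left; apply: cos_neq1.
have n0' : 0 < n%:R :> R by rewrite ltr0n.
have pi0 := @pi_gt0 R.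
rewrite mulrCA; apply/andP; split; first by rewrite !mulr_gt0 ?invr_gt0 ?ltr0n.
rewrite -[ltRHS]mulr1 ltr_pM2l ?mulr_gt0// ltr_pdivrMr// mul1r ltr_nat.
by [].
Qed.

Lemma prod_1B_root n (a w : C) : n.-primitive_root w ->
  \prod_(j < n) (1 - a * w ^+ j) = 1 - a ^+ n.
Proof.
move=> wp; have n0 := prim_order_gt0 wp.
have [->|a0] := eqVneq a 0.
  rewrite expr0n gtn_eqF// subr0 big1// => j _; by rewrite mul0r subr0.
have := factor_Xn_sub_1 wp => /(congr1 (fun q => q.[a^-1])).
have h1 : (1 : {poly C}).[a^-1] = 1 by rewrite -polyC1 hornerC.
rewrite horner_prod hornerD hornerN hornerXn h1 big_mkord => E.
transitivity (a ^+ n * \prod_(i < n) (a^-1 - w ^+ i)).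
  rewrite -[n in a ^+ n]card_ord -prodr_const -big_split/=.
  by apply: eq_bigr => j _; rewrite mulrBr mulfV.
rewrite (eq_bigr (fun i : 'I_n => ('X - (w ^+ i)%:P).[a^-1])); last by move=> i _; rewrite hornerD hornerN hornerX hornerC.
by rewrite E mulrBr mulr1 -exprMn mulfV// expr1n.
Qed.

Lemma conj_cis x v : conjc (1 - cis x * v%:C) = 1 - (cis x)^-1 * v%:C.
Proof.
rewrite cisV; apply/eqP; rewrite eq_complex/= cosN sinN.
by apply/andP; split; apply/eqP; ring.
Qed.

(** The translates are the values 1 - a w^j at the n-th roots of unity w^j,
    with a = v e^(i x), whose product is 1 - a^n. *)
Lemma prod_theta_factor n v x : (0 < n)%N ->
  \prod_(j < n) theta_factor v (x + j%:R * (2 * pi / n%:R)) = theta_factor (v ^+ n) (n%:R * x).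
Proof.
move=> n0; apply: (@complexI R); rewrite rmorph_prod/= theta_factorE.
rewrite (eq_bigr (fun j : 'I_n => (1 - cis x * v%:C * cis (2 * pi / n%:R) ^+ j) *
   conjc (1 - cis x * v%:C * cis (2 * pi / n%:R) ^+ j))); last first.
  move=> j _; rewrite cisX.
  have -> : cis x * v%:C * cis (j%:R * (2 * pi / n%:R)) = cis (x + j%:R * (2 * pi / n%:R)) * v%:C.
    by rewrite cisD; ring.
  by rewrite conj_cis -theta_factorE.
rewrite big_split/= -rmorph_prod (prod_1B_root _ (cis_primitive n0)).
by rewrite exprMn cisX -rC_exp -conj_cis.
Qed.

End RootsOfUnity.

(** * Zolotarev nodes *)

Section Zolotarev.
Local Open Scope classical_set_scope.
Local Open Scope ring_scope.
Variable R : realType.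
Implicit Types (q p x y : R).

(** Up to a constant factor, the Jacobi function dn; it decreases from
    theta_quot q 0 to theta_quot q pi = 1 / theta_quot q 0 on [0, pi]. *)
Definition theta_quot q x : R := theta3 q x / theta3 q (x + pi).
(** A constant multiple of the Jacobi function sn. *)
Definition theta_ratio p x : R := theta1 p x / theta3 p (x + pi).

Lemma theta_quot_gt0 q x : 0 < q < 1 -> 0 < theta_quot q x.
Proof. by move=> q01; rewrite divr_gt0 ?theta3_gt0. Qed.

Lemma sq01 q : 0 < q < 1 -> 0 < q ^+ 2 < 1.
Proof. by move=> /andP[q0 q1]; rewrite exprn_gt0// expr_lte1// ltW. Qed.

Lemma theta_quot_cross q x y : 0 < q < 1 ->
  (theta_quot q x - theta_quot q y) / (theta_quot q x + theta_quot q y) = - q * (theta_ratio (q ^+ 2) (x + y) * theta_ratio (q ^+ 2) (x - y)).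
Proof.
move=> q01; have p01 := sq01 q01.
have t1 := gt_eqF (theta3_gt0 (x + pi) q01); have t2 := gt_eqF (theta3_gt0 (y + pi) q01).
have t3 := gt_eqF (theta3_gt0 (x + y + pi) p01); have t4 := gt_eqF (theta3_gt0 (x - y + pi) p01).
have ha := theta3_add x y q01; have hs := theta3_sub x y q01.
have s0 : 0 < theta3 q x * theta3 q (y + pi) + theta3 q (x + pi) * theta3 q y.
  by rewrite addr_gt0// mulr_gt0// theta3_gt0.
transitivity ((theta3 q x * theta3 q (y + pi) - theta3 q (x + pi) * theta3 q y) /
   (theta3 q x * theta3 q (y + pi) + theta3 q (x + pi) * theta3 q y)).
  rewrite /theta_quot; field.
  by rewrite t1 t2 gt_eqF//= mulrC (mulrC (theta3 q y)) addrC addrC.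
rewrite ha hs /theta_ratio; field.
by rewrite t3 t4.
Qed.

Lemma theta_ratio_cvg p x : 0 < p < 1 ->
  theta_factor 1 x * (theta1_prod p n x) ^+ 2 / (theta3_prod p n x) ^+ 2 @[n --> \oo] --> (theta_ratio p x) ^+ 2.
Proof.
move=> p01; have C0 := qpoch_inf_gt0 (sq01 p01).
have t0 := theta3_gt0 (x + pi) p01.
have -> : (theta_ratio p x) ^+ 2 = ((qpoch_inf (p ^+ 2))^-1 * theta1 p x) ^+ 2 / ((qpoch_inf (p ^+ 2))^-1 * theta3 p (x + pi)) ^+ 2.
  rewrite /theta_ratio; field; rewrite (gt_eqF t0) (gt_eqF C0)//.
have : (2 * sin (x / 2) * theta1_prod p n x) ^+ 2 / (theta3_prod p n x) ^+ 2 @[n --> \oo] -->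
   ((qpoch_inf (p ^+ 2))^-1 * theta1 p x) ^+ 2 / ((qpoch_inf (p ^+ 2))^-1 * theta3 p (x + pi)) ^+ 2.
  apply: cvgM.
    by rewrite expr2; under eq_cvg do rewrite expr2; apply: cvgM; exact: theta1_prod_cvg.
  apply: cvgV; first by rewrite expf_neq0// mulf_neq0// ?invr_neq0// gt_eqF.
  by rewrite expr2; under eq_cvg do rewrite expr2; apply: cvgM; exact: theta3_prod_cvg.
apply: cvg_trans; apply: near_eq_cvg; near=> n.
congr (_ / _); rewrite exprMn; congr (_ * _). rewrite /theta_factor.
have -> : cos x = 1 - 2 * sin (x / 2) ^+ 2.
  by rewrite {1}(splitr x) cosD -[X in X - _]expr2 cos2sin2; ring.
ring.
Unshelve. all: end_near. Qed.

(** In the product formulas [prod_theta_factor] applies factor by factor and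
    turns the nome p into p^n; squaring avoids keeping track of signs. *)
Lemma theta_ratio_subdivide p n x : 0 < p < 1 -> (0 < n)%N ->
  \prod_(j < n) (theta_ratio p (x + j%:R * (2 * pi / n%:R))) ^+ 2 = (theta_ratio (p ^+ n) (n%:R * x)) ^+ 2.
Proof.
move=> p01 n0; have [p0 p1] := andP p01.
have P01 : 0 < p ^+ n < 1 by rewrite exprn_gt0// exprn_ilt1// ?ltW// -lt0n.
pose Rn m p x := theta_factor 1 x * (theta1_prod p m x) ^+ 2 / (theta3_prod p m x) ^+ 2.
have h1 : \prod_(j < n) Rn m p (x + j%:R * (2 * pi / n%:R)) @[m --> \oo] -->
    \prod_(j < n) (theta_ratio p (x + j%:R * (2 * pi / n%:R))) ^+ 2.
  by apply: cvg_prod_ord => j; exact: theta_ratio_cvg.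
have E m : \prod_(j < n) Rn m p (x + j%:R * (2 * pi / n%:R)) = Rn m (p ^+ n) (n%:R * x).
  rewrite /Rn big_split big_split/= prodfV !prodrXl prod_theta_factor// expr1n.
  congr (_ * _ ^+ 2 / _ ^+ 2).
    rewrite /theta1_prod exchange_big/=; apply: eq_bigr => l _.
    by rewrite prod_theta_factor// exprAC.
  rewrite /theta3_prod exchange_big/=; apply: eq_bigr => l _.
  by rewrite prod_theta_factor// exprAC.
have h2 := theta_ratio_cvg (x := n%:R * x) P01.
have h3 : \prod_(j < n) Rn m p (x + j%:R * (2 * pi / n%:R)) @[m --> \oo] --> (theta_ratio (p ^+ n) (n%:R * x)) ^+ 2.
  by under eq_cvg do rewrite E.
exact: cvg_unique h1 h3.
Qed.

Lemma theta3_2pi p x : 0 < p < 1 -> cos x = 1 -> theta3 p x = theta3 p 0.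
Proof. by move=> p01 cx; apply/le_anti; rewrite !theta3_ge// cx cos0. Qed.

Lemma cos_pipi : cos (pi + pi) = 1 :> R.
Proof. by rewrite -mulr2n cos2pi. Qed.

Lemma theta_quot0 q : 0 < q < 1 -> theta_quot q 0 = theta3 q 0 / theta3 q pi.
Proof. by move=> q01; rewrite /theta_quot add0r. Qed.

Lemma theta_quotpi q : 0 < q < 1 -> theta_quot q pi = theta3 q pi / theta3 q 0.
Proof. by move=> q01; rewrite /theta_quot (theta3_2pi q01 cos_pipi). Qed.

Lemma theta_quot_bounds q x : 0 < q < 1 -> theta_quot q pi <= theta_quot q x <= theta_quot q 0.
Proof.
move=> q01; rewrite theta_quot0// theta_quotpi// /theta_quot.
have t0 := theta3_gt0 0 q01; have tpi := theta3_gt0 pi q01.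
have tx := theta3_gt0 x q01; have txpi := theta3_gt0 (x + pi) q01.
have h1 z : theta3 q z <= theta3 q 0 by apply: theta3_ge; rewrite // cos0 cos_le1.
have h2 z : theta3 q pi <= theta3 q z by apply: theta3_ge; rewrite // cospi cos_geN1.
by apply/andP; split; apply: ler_pM;
  rewrite ?lef_pV2 ?posrE ?invr_ge0 ?(ltW t0) ?(ltW tpi) ?(ltW tx) ?(ltW txpi).
Qed.

Lemma theta1_le p x : 0 < p < 1 -> `|theta1 p x| <= 2 * theta3 p 0.
Proof.
move=> p01; have [p0 p1] := andP p01; have r01 : 0 <= p < 1 by rewrite ltW.
have hT := zpartial_cvg r01 (theta3_term_dom 0 p01).
have hU := zpartial_cvg r01 (theta1_term_dom x p01).
have h : 2 * zpartial n (theta3_term p 0) - `|zpartial n (theta1_term p x)| @[n --> \oo] --> 2 * theta3 p 0 - `|theta1 p x|.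
  by apply: cvgB; [apply: cvgM => //; exact: cvg_cst|exact: cvg_norm].
rewrite -subr_ge0; apply: (cvg_ge_near h); near=> n.
rewrite subr_ge0 /zpartial mulr_sumr; apply: (le_trans (ler_norm_sum _ _ _)).
apply: ler_sum => i _; rewrite /theta3_term !mulr0 cos0 !mulr1 sqz_Posz sqz_Negz.
have h1 : `|theta1_term p x (Posz i)| <= p ^+ (i * i + i).
  rewrite /theta1_term sqzD_Posz normrM normrM norm_signz mul1r ger0_norm ?exprn_ge0 ?(ltW p0)//.
  by rewrite ler_piMr ?sin_max// exprn_ge0 ?(ltW p0).
have h2 : `|theta1_term p x (Negz i)| <= p ^+ (i * i + i).
  rewrite /theta1_term sqzD_Negz normrM normrM norm_signz mul1r ger0_norm ?exprn_ge0 ?(ltW p0)//.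
  by rewrite ler_piMr ?sin_max// exprn_ge0 ?(ltW p0).
have h3 : p ^+ (i * i + i) <= p ^+ (i * i).
  by apply: (ler_wiXn2l (ltW p0) (ltW p1)); lia.
have h4 : 0 <= p ^+ (i.+1 * i.+1) by rewrite exprn_ge0 ?(ltW p0).
have := ler_normD (theta1_term p x (Posz i)) (theta1_term p x (Negz i)).
rewrite -!exprnP; lra.
Unshelve. all: end_near. Qed.

(** At y = 0, and for the nome sqrt p, [theta_quot_cross] writes the square of
    theta_ratio p x as a decreasing function of theta_quot; it is largest at
    x = pi, where the two theta series are compared term by term. *)
Lemma theta_ratio_le2 p x : 0 < p < 1 -> (theta_ratio p x) ^+ 2 <= 4.
Proof.
move=> p01; have [p0 p1] := andP p01.
pose q := Num.sqrt p; have q2 : q ^+ 2 = p by rewrite sqr_sqrtr// ltW.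
have q0 : 0 < q by rewrite sqrtr_gt0.
have q01 : 0 < q < 1 by rewrite q0 -(@expr_lt1 _ 2) ?(ltW q0)// q2.
have h1 := theta_quot_cross x 0 q01; have h2 := theta_quot_cross pi 0 q01.
rewrite q2 !addr0 !subr0 in h1 h2.
have [b1 b2] := andP (theta_quot_bounds x q01).
have a0 := theta_quot_gt0 0 q01; have ax := theta_quot_gt0 x q01; have api := theta_quot_gt0 pi q01.
have wpi : (theta_ratio p pi) ^+ 2 <= 4.
  have t0 := theta3_gt0 0 p01.
  have : `|theta_ratio p pi| <= 2.
    rewrite /theta_ratio (theta3_2pi p01 cos_pipi) normrM normfV (gtr0_norm t0) ler_pdivrMr//.
    exact: theta1_le.
  move=> h; rewrite -real_normK ?num_real//.
  have := ler_pM (normr_ge0 _) (normr_ge0 _) h h; rewrite expr2; lra.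
apply: le_trans wpi; rewrite -(ler_pM2l q0) -lerN2 -!mulNr !expr2 -h1 -h2.
rewrite ler_pdivrMr ?addr_gt0// mulrAC ler_pdivlMr ?addr_gt0//.
nra.
Qed.

Definition zol_node q (k : nat) (j : nat) : R := theta_quot q ((2 * j%:R + 1) * pi / (2 * k%:R)).

(** By [theta_quot_cross] each factor is - q times the product of theta_ratio at
    x + y_j and x - y_j, where y_j = (2 j + 1) pi / (2 k).  The 2 k arguments are
    equally spaced over a period, so the product collapses by subdivision. *)
Lemma zolotarev_bound q k x : 0 < q < 1 -> (0 < k)%N ->
  `|\prod_(j < k) ((theta_quot q x - zol_node q k j) / (theta_quot q x + zol_node q k j))| <= 2 * q ^+ k.
Proof.
move=> q01 k0; have [q0 q1] := andP q01; set p := q ^+ 2.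
have p01 : 0 < p < 1 by exact: sq01.
have N0 : (0 < k + k)%N by rewrite addn_gt0 k0.
have P01 : 0 < p ^+ (k + k) < 1.
  by case/andP: p01 => p0 p1; rewrite exprn_gt0// exprn_ilt1// ?ltW// -lt0n.
rewrite -(@ler_pXn2r _ 2) ?nnegrE ?mulr_ge0 ?exprn_ge0 ?(ltW q0)//.
rewrite real_normK ?num_real// -prodrXl.
pose y j : R := (2 * j%:R + 1) * pi / (2 * k%:R).
pose g j := (theta_ratio p (x + y j)) ^+ 2 * (theta_ratio p (x - y j)) ^+ 2.
rewrite (eq_bigr (fun j : 'I_k => q ^+ 2 * g j)); last first.
  by move=> j _; rewrite /zol_node theta_quot_cross// -/p /g -/(y j); move: (theta_ratio p _) (theta_ratio p _) => u v; rewrite /p; ring.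
rewrite big_split/= prodr_const card_ord.
have k0' : k%:R != 0 :> R by rewrite pnatr_eq0 -lt0n.
have -> : \prod_(j < k) g j = (theta_ratio (p ^+ (k + k)) ((k + k)%:R * (x - y k.-1))) ^+ 2.
  rewrite -(theta_ratio_subdivide _ p01 N0) big_split_ord/= [in LHS]big_split/= mulrC.
  congr (_ * _).
    rewrite (reindex_inj rev_ord_inj)/=; apply: eq_bigr => j _.
    congr (theta_ratio p _ ^+ 2); rewrite /y.
    have jk := ltn_ord j.
    rewrite natrB// -subn1 natrB// natrD -natr1; field.
    by rewrite -natrD pnatr_eq0 -lt0n N0 k0'.
  apply: eq_bigr => j _; congr (theta_ratio p _ ^+ 2); rewrite /y.
  rewrite -subn1 natrB// !natrD; field.
  by rewrite -natrD pnatr_eq0 -lt0n N0 k0'.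
have := theta_ratio_le2 ((k + k)%:R * (x - y k.-1)) P01.
have qk : 0 <= (q ^+ 2) ^+ k by rewrite !exprn_ge0// ltW.
move=> /(ler_wpM2l qk); have -> : (2 * q ^+ k) ^+ 2 = (q ^+ 2) ^+ k * 4.
  by rewrite exprMn exprAC; ring.
by rewrite -/p.
Qed.

End Zolotarev.

(** * The modulus as a function of the nome *)

Section Modulus.
Local Open Scope classical_set_scope.
Local Open Scope ring_scope.
Variable R : realType.
Implicit Types (q p x y : R).

Lemma theta3_continuous q : 0 < q < 1 -> continuous (theta3 q).
Proof.
move=> q01 x; have [q0 q1] := andP q01; have r01 : 0 <= q < 1 by rewrite ltW.
refine (@tannery R R (nbhs x) _ (fun y i => theta3_term q y (Posz i) + theta3_term q y (Negz i)) _ (2 * 1) q r01 _ _).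
  by apply: nearW => y i; exact: zdom_pair (theta3_term_dom y q01).
move=> i.
have hc (m : R) : cos (m * y) @[y --> x] --> cos (m * x).
  by apply: (continuous_comp (f := fun y => m * y)); [exact: mulrl_continuous|exact: continuous_cos].
by apply: cvgD; apply: cvgM; [exact: cvg_cst|exact: hc|exact: cvg_cst|exact: hc].
Unshelve. all: end_near. Qed.

Lemma theta3_continuous_nome x q : 0 < q < 1 -> {for q, continuous (fun q => theta3 q x)}.
Proof.
move=> q01; have [q0 q1] := andP q01; pose r := (1 + q) / 2.
have r01 : 0 <= r < 1 by rewrite /r; apply/andP; split; lra.
refine (@tannery R R (nbhs q) _ (fun q i => theta3_term q x (Posz i) + theta3_term q x (Negz i)) _ (2 * 1) r r01 _ _).
  have qr : q < r by rewrite /r; lra.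
  have h1 : \forall y \near q, 0 < y by exact: lt_nbhsr.
  have h2 : \forall y \near q, y < r by exact: lt_nbhsl.
  near=> y => i.
  have y0 : 0 < y by near: y.
  have yr : y < r by near: y.
  have y01 : 0 < y < 1 by rewrite y0 (lt_trans yr)//; case/andP: r01.
  apply: (le_trans (zdom_pair i (theta3_term_dom x y01))).
  rewrite ler_wpM2l ?mulr_ge0// lerXn2r ?nnegrE ?(ltW y0) ?(ltW yr)//.
  by case/andP: r01.
move=> i; apply: cvgD.
  by rewrite /theta3_term sqz_Posz; apply: cvgM; [exact: exprn_continuous|exact: cvg_cst].
by rewrite /theta3_term sqz_Negz; apply: cvgM; [exact: exprn_continuous|exact: cvg_cst].
Unshelve. all: end_near. Qed.

Lemma theta3_0_ge q n : 0 < q < 1 -> \sum_(i < n) q ^+ (i * i) <= theta3 q 0.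
Proof.
move=> q01; have [q0 q1] := andP q01; have r01 : 0 <= q < 1 by rewrite ltW.
apply: (cvg_ge_near (zpartial_cvg r01 (theta3_term_dom 0 q01))); near=> m.
have nm : (n <= m)%N by near: m; exact: nbhs_infty_ge.
rewrite /zpartial big_split/= -[leLHS]addr0; apply: lerD; last first.
  by apply: sumr_ge0 => i _; rewrite /theta3_term mulr0 cos0 mulr1 sqz_Negz exprn_ge0 ?(ltW q0).
rewrite -(subnKC nm) big_split_ord/= -[leLHS]addr0; apply: lerD; last first.
  by apply: sumr_ge0 => i _; rewrite /theta3_term mulr0 cos0 mulr1 sqz_Posz exprn_ge0 ?(ltW q0).
by apply: ler_sum => i _; rewrite /theta3_term mulr0 cos0 mulr1 sqz_Posz.
Unshelve. all: end_near. Qed.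

Lemma theta3_near1 q x : 0 < q <= 1 / 2 -> `|theta3 q x - 1| <= 6 * q.
Proof.
move=> /andP[q0 q2]; have q01 : 0 < q < 1 by apply/andP; split; lra.
have r01 : 0 <= q < 1 by apply/andP; split; lra.
have E0 : theta3_term q x (Posz 0) + theta3_term q x (Negz 0) = 1 + q * cos x.
  rewrite /theta3_term sqz_Posz sqz_Negz -!exprnP mul0n mul1n expr0 expr1 mul0r cos0 mul1r.
  by rewrite NegzE mulrNz mulNr cosN mul1r.
have := @geo_tail R _ _ _ 1 r01 (fun i => zdom_pair i (theta3_term_dom x q01)).
rewrite -/(zsum _) -/(theta3 q x) big_ord1 E0 mulr1 expr1.
have c2 : `|q * cos x| <= q by rewrite normrM gtr0_norm// ler_piMr ?cos_max// ltW.
have : 2 * q / (1 - q) <= 4 * q by rewrite ler_pdivrMr; nra.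
move: c2; rewrite !ler_norml; set u := q * cos _ => /andP[? ?] ? /andP[? ?].
by apply/andP; split; lra.
Qed.

(** The complementary modulus k' belonging to the nome q. *)
Definition comod q : R := (theta3 q pi / theta3 q 0) ^+ 2.

Lemma comod_ratio01 q : 0 < q < 1 -> 0 < theta3 q pi / theta3 q 0 /\ theta3 q pi / theta3 q 0 <= (1 + q)^-1.
Proof.
move=> q01; have [q0 q1] := andP q01.
have t0 := theta3_gt0 0 q01; have tpi := theta3_gt0 pi q01.
split; first by rewrite divr_gt0.
have := theta3_0_ge 2 q01; rewrite big_ord_recr big_ord1/= mul0n mul1n expr0 expr1 => h.
rewrite ler_pdivrMr// -(ler_pM2l (_ : 0 < 1 + q)) ?addr_gt0//.
rewrite mulrA divff ?mul1r ?gt_eqF ?addr_gt0//.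
have := theta3_pi_le1 q01; move=> h1; apply: le_trans h.
by rewrite -[leRHS]mulr1 ler_wpM2l// addr_ge0// ltW.
Qed.

Lemma comod01 q : 0 < q < 1 -> 0 < comod q < 1.
Proof.
move=> q01; have [h1 h2] := comod_ratio01 q01; have [q0 q1] := andP q01.
rewrite /comod exprn_gt0//= expr_lt1 ?ltW// (le_lt_trans h2)//.
by rewrite invf_lt1 ?addr_gt0// ltrDl.
Qed.

Lemma comod_compl_ge q : 0 < q < 1 -> q / 2 <= 1 - comod q ^+ 2.
Proof.
move=> q01; have [h1 h2] := comod_ratio01 q01; have [q0 q1] := andP q01.
have [k0 k1] := andP (comod01 q01).
have h3 : q / 2 <= 1 - (1 + q)^-1.
  have : (1 + q)^-1 * (1 + q) = 1 by rewrite mulVf// gt_eqF// addr_gt0.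
  have : 0 < (1 + q)^-1 by rewrite invr_gt0 addr_gt0.
  set u := (1 + q)^-1 => u0 uE; nra.
have : comod q <= theta3 q pi / theta3 q 0.
  by rewrite /comod expr2 ler_piMl ?(ltW h1)// (le_trans h2)// invf_le1 ?addr_gt0// lerDl ltW.
rewrite expr2; nra.
Qed.

(** The cases x = y = 0 and x = pi, y = 0 of [theta3_add] are the arithmetic
    and geometric mean relations between theta constants of nomes q and q^2. *)
Lemma comod_landen q : 0 < q < 1 ->
  comod (q ^+ 2) = 2 * Num.sqrt (comod q) / (1 + comod q).
Proof.
move=> q01; have p01 := sq01 q01.
have t0 := theta3_gt0 0 q01; have tpi := theta3_gt0 pi q01.
have p0 := theta3_gt0 0 p01; have ppi := theta3_gt0 pi p01.
rewrite {2}/comod sqrtr_sqr gtr0_norm ?divr_gt0//.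
have h1 := theta3_add 0 0 q01; have h2 := theta3_add pi 0 q01.
rewrite !(subr0, add0r, oppr0) in h1.
rewrite !(add0r, addr0, subr0, oppr0) !(theta3_2pi _ (cos_pipi R))// in h2.
have E1 : theta3 (q ^+ 2) pi ^+ 2 = theta3 q 0 * theta3 q pi by rewrite expr2; lra.
have E2 : theta3 (q ^+ 2) 0 ^+ 2 = (theta3 q 0 ^+ 2 + theta3 q pi ^+ 2) / 2.
  by rewrite !expr2; lra.
rewrite /comod expr_div_n E1 E2; field.
rewrite !gt_eqF//= ?addr_gt0 ?exprn_gt0//.
Qed.

Lemma bernoulli_ge (x : R) n : 0 <= x <= 1 -> 1 - n%:R * x <= (1 - x) ^+ n.
Proof.
move=> /andP[x0 x1]; elim: n => [|n IH]; first by rewrite mul0r subr0.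
rewrite exprSr; apply: (@le_trans _ _ ((1 - n%:R * x) * (1 - x))).
  have : 0 <= n%:R * x * x by rewrite !mulr_ge0.
  by rewrite -natr1; lra.
by rewrite ler_wpM2r// subr_ge0.
Qed.

Lemma comod_surj (l : R) : 0 < l < 1 -> exists2 q, 0 < q < 1 & comod q = l.
Proof.
move=> /andP[l0 l1]; pose s := Num.sqrt l.
have s0 : 0 < s by rewrite sqrtr_gt0.
have s2 : s ^+ 2 = l by rewrite sqr_sqrtr// ltW.
have s1 : s < 1 by rewrite -(@expr_lt1 _ 2) ?(ltW s0)// s2.
pose f q := theta3 q pi / theta3 q 0.
suff [q q01 fq] : exists2 q, 0 < q < 1 & f q = s.
  by exists q => //; rewrite /comod -/(f q) fq s2.
(* For small q the quotient of theta constants is at least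
   (1 - 6 q) / (1 + 6 q) >= 1 - 12 q. *)
pose q1 := (1 - s) / 12.
have q101 : 0 < q1 <= 1 / 2 by rewrite /q1; apply/andP; split; lra.
have fq1 : s <= f q1.
  have [q10 q12] := andP q101.
  have := theta3_near1 pi q101; have := theta3_near1 0 q101.
  rewrite !ler_norml => /andP[? ?] /andP[? ?].
  rewrite /f ler_pdivlMr; last by apply: theta3_gt0; apply/andP; split; lra.
  apply: (@le_trans _ _ (s * (1 + 6 * q1))); first by rewrite ler_pM2l//; lra.
  have : s * (6 * q1) <= 6 * q1 by rewrite ler_piMl// ?ltW//; lra.
  have : 12 * q1 = 1 - s by rewrite /q1; lra.
  lra.
pose N := (Num.truncn (2 / s)).+1.
have N0 : 0 < N%:R :> R by rewrite ltr0n.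
have Ns : 2 / s < N%:R by rewrite truncnS_gt.
have N2 : 2 < N%:R :> R.
  by apply: lt_trans Ns; rewrite ltr_pdivlMr// gtr_pMr.
(* With q2 = 1 - x, Bernoulli's inequality makes each of the first N terms of
   the theta series at 0 at least 1 / 2. *)
pose x := (2 * (N%:R) ^+ 2)^-1 : R.
have x0 : 0 < x by rewrite invr_gt0 mulr_gt0// exprn_gt0.
have xN : N%:R ^+ 2 * x = 1 / 2.
  by rewrite /x; field; rewrite gt_eqF.
have x1 : x <= 1 / 2 by nra.
pose q2 := 1 - x.
have q201 : 0 < q2 < 1 by rewrite /q2; apply/andP; split; lra.
have fq2 : f q2 <= s.
  rewrite /f ler_pdivrMr ?theta3_gt0//; apply: (le_trans (theta3_pi_le1 q201)).
  apply: (@le_trans _ _ (s * (N%:R / 2))).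
    have : 2 < N%:R * s by rewrite -ltr_pdivrMr.
    lra.
  rewrite ler_pM2l//; apply: le_trans (theta3_0_ge N q201).
  apply: (@le_trans _ _ (\sum_(i < N) (1 / 2))).
    by rewrite sumr_const card_ord -[leRHS]mulr_natl; lra.
  apply: ler_sum => i _; have [q20 q21] := andP q201.
  apply: (@le_trans _ _ (q2 ^+ (N * N))); last first.
    by apply: (ler_wiXn2l (ltW q20) (ltW q21)); rewrite leq_mul// ltnW.
  apply: le_trans (bernoulli_ge (N * N) _); last by apply/andP; split; lra.
  by rewrite natrM -expr2 xN; lra.
have q12 : q1 <= q2 by rewrite /q1 /q2; lra.
have cf : {within `[q1, q2], continuous f}.
  apply: continuous_in_subspaceT => q; rewrite inE/= in_itv/= => /andP[h1 h2].
  have q01 : 0 < q < 1.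
    by case/andP: q101 => ? _; case/andP: q201 => _ ?; apply/andP; split; lra.
  apply: cvgM; first exact: theta3_continuous_nome.
  by apply: cvgV; [rewrite gt_eqF// theta3_gt0 | exact: theta3_continuous_nome].
have [|q qi fq] := IVT q12 cf (v := s).
  by rewrite ge_min fq2 orbT le_max fq1.
exists q => //; move: qi; rewrite in_itv/= => /andP[h1 h2].
by case/andP: q101 => ? _; case/andP: q201 => _ ?; apply/andP; split; lra.
Qed.

Lemma theta_quot_surj q v : 0 < q < 1 -> theta_quot q pi <= v <= theta_quot q 0 -> exists x, theta_quot q x = v.
Proof.
move=> q01 vb; have cX : {within `[0, pi], continuous (theta_quot q)}.
  apply: continuous_subspaceT => x; apply: cvgM; first exact: theta3_continuous.
  apply: cvgV; first by rewrite gt_eqF// theta3_gt0.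
  apply: (continuous_comp (f := fun x => x + pi)); last exact: theta3_continuous.
  by apply: cvgD; [exact: cvg_id|exact: cvg_cst].
have [|x _ xv] := IVT (pi_ge0 R) cX (v := v); last by exists x.
by case/andP: vb => v1 v2; rewrite ge_min v1 orbT le_max v2.
Qed.

(** The nodes are rescaled by sqrt (a b): the range of theta_quot q is
    [sqrt (a / b), sqrt (b / a)]. *)
Lemma zolotarev_interval (a b q : R) (k : nat) : 0 < a -> a < b -> 0 < q < 1 ->
  comod q = a / b -> (0 < k)%N ->
  exists2 z : nat -> R, (forall i, 0 < z i) &
    forall x, a <= x <= b -> `|\prod_(i < k) ((x - z i) / (x + z i))| <= 2 * q ^+ k.
Proof.
move=> a0 ab q01 kq k0; have b0 : 0 < b by exact: lt_trans ab.
pose c := Num.sqrt (a * b).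
have c0 : 0 < c by rewrite sqrtr_gt0 mulr_gt0.
have c2 : c ^+ 2 = a * b by rewrite sqr_sqrtr// ltW// mulr_gt0.
have z0 i : 0 < zol_node q k i by exact: theta_quot_gt0.
exists (fun i => c * zol_node q k i) => [i|x /andP[ax xb]]; first by rewrite mulr_gt0.
have x0 : 0 < x by exact: lt_le_trans ax.
have [t xt] : exists t, theta_quot q t = x / c.
  apply: theta_quot_surj => //; rewrite theta_quotpi// theta_quot0//.
  have t0 := theta3_gt0 0 q01; have tpi := theta3_gt0 pi q01.
  have xc : (x / c) ^+ 2 = x ^+ 2 / (a * b) by rewrite expr_div_n c2.
  have E1 : (theta3 q 0 / theta3 q pi) ^+ 2 = b / a by rewrite -invf_div exprVn -/(comod q) kq invf_div.
  apply/andP; split.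
    rewrite -(@ler_pXn2r _ 2) ?nnegrE ?divr_ge0 ?(ltW t0) ?(ltW tpi) ?(ltW x0) ?(ltW c0)//.
    rewrite -/(comod q) kq xc ler_pdivlMr ?mulr_gt0//.
    have -> : a / b * (a * b) = a ^+ 2 by field; rewrite gt_eqF.
    by rewrite lerXn2r ?nnegrE ?(ltW a0) ?(ltW x0).
  rewrite -(@ler_pXn2r _ 2) ?nnegrE ?divr_ge0 ?(ltW t0) ?(ltW tpi) ?(ltW x0) ?(ltW c0)//.
  rewrite E1 xc ler_pdivrMr ?mulr_gt0//.
  have -> : b / a * (a * b) = b ^+ 2 by field; rewrite gt_eqF.
  by rewrite lerXn2r ?nnegrE ?(ltW b0) ?(ltW x0).
have := zolotarev_bound t q01 k0.
rewrite xt (eq_bigr (fun i : 'I_k => (x - c * zol_node q k i) / (x + c * zol_node q k i)))//.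
move=> i _; have := z0 i; move: (zol_node q k i) => z z00.
by field; rewrite !gt_eqF// addr_gt0// mulr_gt0.
Qed.

End Modulus.

(** * The complete elliptic integral *)

Section Elliptic.
Local Open Scope classical_set_scope.
Local Open Scope ring_scope.
Variable R : realType.
Implicit Types (l k t c : R).
Local Notation mu := (@lebesgue_measure R).

Definition ell_integrand l t : R := (Num.sqrt ((1 - t ^+ 2) * (1 - l ^+ 2 * t ^+ 2)))^-1.

Lemma within_co (g : R -> R) (A : set R) :
  A `<=` `[0, 1[ -> (forall t, 0 <= t < 1 -> {for t, continuous g}) ->
  {within A, continuous g}.
Proof.
move=> Asub cg; apply: continuous_in_subspaceT => t; rewrite inE => /Asub/=.
by rewrite in_itv/=; exact: cg.
Qed.

Lemma measurable_co (g : R -> R) (A : set R) : measurable A ->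
  A `<=` `[0, 1[ -> (forall t, 0 <= t < 1 -> {for t, continuous g}) ->
  measurable_fun A g.
Proof.
by move=> mA Asub cg; apply: subspace_continuous_measurable_fun => //; exact: within_co.
Qed.

Lemma cc_sub_co c : c < 1 -> `[0, c] `<=` `[0, 1[%classic.
Proof.
move=> c1 t/=; rewrite !in_itv/= => /andP[-> tc]/=; exact: le_lt_trans c1.
Qed.

Lemma integral_co_cc (g : R -> R) : (forall t, 0 <= t < 1 -> {for t, continuous g}) ->
  (\int[mu]_(t in `[0%R, 1%R]) (g t)%:E = \int[mu]_(t in `[0%R, 1%R[) (g t)%:E)%E.
Proof.
by move=> cg; rewrite -integral_itv_bndo_bndc//; apply/measurable_EFinP; exact: measurable_co.
Qed.

(** Integrands that blow up at 1 are controlled through their integrals over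
    [0, c] with c < 1, by monotone convergence. *)
Lemma integral_le_sup (g : R -> R) (B : R) :
  (forall t, 0 <= t < 1 -> {for t, continuous g}) -> (forall t, 0 <= t < 1 -> 0 <= g t) ->
  (forall c, 0 < c < 1 -> (\int[mu]_(t in `[0%R, c]) (g t)%:E <= B%:E)%E) ->
  (\int[mu]_(t in `[0%R, 1%R]) (g t)%:E <= B%:E)%E.
Proof.
move=> cg g0 gB; rewrite integral_co_cc// itv_bnd_open_bigcup.
have n1 n : 1 - n.+1%:R^-1 < 1 :> R by rewrite ltrBlDr ltrDl invr_gt0 ltr0n.
have cv : (\int[mu]_(t in `[0%R, (1 - n.+1%:R^-1)%R]%classic) (g t)%:E)%E @[n --> \oo] -->
  (\int[mu]_(t in \bigcup_n `[0%R, (1 - n.+1%:R^-1)%R]%classic) (g t)%:E)%E.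
  apply: (@ge0_nondecreasing_set_cvg_integral _ _ R) => //.
  - apply/nondecreasing_seqP => n; rewrite subsetEset => t/=; rewrite !in_itv/= => /andP[-> h]/=.
    apply: (le_trans h); rewrite lerD2l lerN2 lef_pV2 ?posrE ?ltr0n// ler_nat.
    by [].
  - move=> n; apply/measurable_EFinP; apply: measurable_co => //; exact: cc_sub_co.
  - by move=> n t /(cc_sub_co (n1 n)); rewrite /= in_itv/= lee_fin; exact: g0.
rewrite -(cvg_lim _ cv)//; apply: lime_le; first by apply/cvg_ex; eexists; exact: cv.
near=> n; apply: gB; rewrite n1 andbT subr_gt0 invf_lt1 ?ltr0n// ltr1n.
by near: n; exists 1%N.
Unshelve. all: end_near. Qed.

Lemma ell_integrand_arg_gt0 l t : 0 <= l < 1 -> 0 <= t < 1 ->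
  0 < 1 - t ^+ 2 /\ 0 < 1 - l ^+ 2 * t ^+ 2.
Proof.
move=> /andP[l0 l1] /andP[t0 t1].
have t2 : t ^+ 2 < 1 by rewrite expr_lt1.
have l2 : l ^+ 2 <= 1 by rewrite expr_le1// ltW.
have := sqr_ge0 t; have := sqr_ge0 l; nra.
Qed.

Lemma ell_integrand_continuous l t : 0 <= l < 1 -> 0 <= t < 1 -> {for t, continuous (ell_integrand l)}.
Proof.
move=> l01 t01; have [h1 h2] := ell_integrand_arg_gt0 l01 t01.
apply: cvgV; first by rewrite sqrtr_eq0 -ltNge mulr_gt0.
apply: (continuous_comp (f := fun t => (1 - t ^+ 2) * (1 - l ^+ 2 * t ^+ 2))).
  have hx : x ^+ 2 @[x --> t] --> t ^+ 2 by exact: exprn_continuous.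
  apply: cvgM; apply: cvgB; try exact: cvg_cst; first exact: hx.
  by apply: cvgM; [exact: cvg_cst|exact: hx].
exact: sqrt_continuous.
Qed.

Lemma ell_integrand_ge0 l t : 0 <= ell_integrand l t.
Proof. by rewrite invr_ge0 sqrtr_ge0. Qed.

Lemma ellipticK_ge l c : 0 <= l < 1 -> 0 < c < 1 ->
  (\int[mu]_(t in `[0%R, 1%R]) (ell_integrand l t)%:E \is a fin_num)%E ->
  (\int[mu]_(t in `[0%R, c]) (ell_integrand l t)%:E <= (ellipticK l)%:E)%E.
Proof.
move=> l01 /andP[c0 c1] lfin; rewrite /ellipticK /Rintegral fineK//.
have cg t : 0 <= t < 1 -> {for t, continuous (ell_integrand l)} by exact: ell_integrand_continuous.
rewrite integral_co_cc//; apply: ge0_subset_integral => //.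
- by apply/measurable_EFinP; exact: measurable_co.
- by move=> t _; rewrite lee_fin ell_integrand_ge0.
- exact: cc_sub_co.
Qed.

Lemma ellipticK_fin l (B : R) : 0 <= l < 1 ->
  (forall c, 0 < c < 1 -> (\int[mu]_(t in `[0%R, c]) (ell_integrand l t)%:E <= B%:E)%E) ->
  (\int[mu]_(t in `[0%R, 1%R]) (ell_integrand l t)%:E \is a fin_num)%E /\ ellipticK l <= B.
Proof.
move=> l01 h.
have le : (\int[mu]_(t in `[0%R, 1%R]) (ell_integrand l t)%:E <= B%:E)%E.
  by apply: integral_le_sup => // t t01; [exact: ell_integrand_continuous|exact: ell_integrand_ge0].
have ge : (0 <= \int[mu]_(t in `[0%R, 1%R]) (ell_integrand l t)%:E)%E.
  by apply: integral_ge0 => t _; rewrite lee_fin ell_integrand_ge0.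
have fin : (\int[mu]_(t in `[0%R, 1%R]) (ell_integrand l t)%:E \is a fin_num)%E.
  by rewrite ge0_fin_numE// (le_lt_trans le)// ltry.
by split => //; rewrite -lee_fin /ellipticK /Rintegral fineK.
Qed.

(** The integrand of modulus sqrt (1 - k^2) is 1 / (v S) with v^2 = 1 - t^2 and
    S^2 = v^2 + k^2 t^2.  Replacing it by t / (v W) with W^2 = v^2 + k^2, which
    has the primitive - ln (v + W), costs at most 2 at each point. *)
Let dom_primitive k t : R := 2 * t - ln (Num.sqrt (1 - t ^+ 2) + Num.sqrt (1 - t ^+ 2 + k ^+ 2)).
Let dom_bound k t : R := 2 + t * (Num.sqrt (1 - t ^+ 2) * Num.sqrt (1 - t ^+ 2 + k ^+ 2))^-1.

Let dom_primitive_derive k t : -1 < t < 1 -> is_derive t 1 (dom_primitive k) (dom_bound k t).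
Proof.
move=> /andP[tN1 t1].
have h1 : 0 < 1 - t ^+ 2 by rewrite expr2; nra.
have h2 : 0 < 1 - t ^+ 2 + k ^+ 2 by rewrite ltr_wpDr// sqr_ge0.
have v0 : 0 < Num.sqrt (1 - t ^+ 2) by rewrite sqrtr_gt0.
have W0 : 0 < Num.sqrt (1 - t ^+ 2 + k ^+ 2) by rewrite sqrtr_gt0.
have d1 : is_derive t 1 (fun t : R => 1 - t ^+ 2) (- (2 * t)).
  by apply: is_derive_eq; rewrite /GRing.scale/=; ring.
have d2 : is_derive t 1 (fun t : R => 1 - t ^+ 2 + k ^+ 2) (- (2 * t)).
  by apply: is_derive_eq; rewrite addr0.
have e1 := is_derive1_comp (g := fun t : R => 1 - t ^+ 2) (is_derive1_sqrt h1) d1.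
have e2 := is_derive1_comp (g := fun t : R => 1 - t ^+ 2 + k ^+ 2) (is_derive1_sqrt h2) d2.
have e3 := is_deriveD e1 e2.
have e4 := is_derive1_comp (g := (Num.sqrt \o (fun t : R => 1 - t ^+ 2)) + (Num.sqrt \o (fun t : R => 1 - t ^+ 2 + k ^+ 2)))
  (is_derive1_ln (addr_gt0 v0 W0)) e3.
have e5 : is_derive t 1 (fun t : R => 2 * t) 2.
  by apply: is_derive_eq; rewrite /GRing.scale/=; ring.
apply: (is_derive_eq (is_deriveB e5 e4)).
rewrite /dom_bound; move: v0 W0; set v := Num.sqrt _; set W := Num.sqrt _ => v0 W0.
by field; rewrite !gt_eqF//= addr_gt0.
Qed.


Let ell_integrand_le_dom k t : 0 < k < 1 -> 0 <= t < 1 -> ell_integrand (Num.sqrt (1 - k ^+ 2)) t <= dom_bound k t.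
Proof.
move=> /andP[k0 k1] /andP[t0 t1]; rewrite /ell_integrand /dom_bound.
have k2 : k ^+ 2 < 1 by rewrite expr_lt1// ltW.
rewrite sqr_sqrtr ?subr_ge0 ?(ltW k2)//.
have h1 : 0 < 1 - t ^+ 2 by rewrite subr_gt0 expr_lt1.
have -> : 1 - (1 - k ^+ 2) * t ^+ 2 = (1 - t ^+ 2) + k ^+ 2 * t ^+ 2 by ring.
have h2 : 0 < 1 - t ^+ 2 + k ^+ 2 by rewrite ltr_wpDr// sqr_ge0.
have h3 : 0 < 1 - t ^+ 2 + k ^+ 2 * t ^+ 2 by rewrite ltr_wpDr// mulr_ge0 ?sqr_ge0.
rewrite sqrtrM ?(ltW h1)//.
have v0 : 0 < Num.sqrt (1 - t ^+ 2) by rewrite sqrtr_gt0.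
have W0 : 0 < Num.sqrt (1 - t ^+ 2 + k ^+ 2) by rewrite sqrtr_gt0.
have S0 : 0 < Num.sqrt (1 - t ^+ 2 + k ^+ 2 * t ^+ 2) by rewrite sqrtr_gt0.
have v2 : Num.sqrt (1 - t ^+ 2) ^+ 2 = 1 - t ^+ 2 by rewrite sqr_sqrtr// ltW.
have W2 : Num.sqrt (1 - t ^+ 2 + k ^+ 2) ^+ 2 = 1 - t ^+ 2 + k ^+ 2 by rewrite sqr_sqrtr// ltW.
have S2 : Num.sqrt (1 - t ^+ 2 + k ^+ 2 * t ^+ 2) ^+ 2 = 1 - t ^+ 2 + k ^+ 2 * t ^+ 2.
  by rewrite sqr_sqrtr// ltW.
move: v0 W0 S0 v2 W2 S2; set v := Num.sqrt _; set W := Num.sqrt _; set S := Num.sqrt _.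
move=> v0 W0 S0 v2 W2 S2.
have t2 : 0 <= t ^+ 2 by exact: sqr_ge0.
(* For t <= 1/2 the integrand itself is at most 2; otherwise S >= t W and
   1 / (t v W) - t / (v W) = v / (t W) <= 1 / t <= 2. *)
have [th|th] := leP t (1 / 2).
  have vS : 1 / 2 <= v * S.
    have vleS : v <= S.
      by rewrite -(@ler_pXn2r _ 2) ?nnegrE ?(ltW v0) ?(ltW S0)// v2 S2 lerDl mulr_ge0 ?sqr_ge0.
    have : 3 / 4 <= v ^+ 2 by rewrite v2 expr2; nra.
    by rewrite expr2; nra.
  apply: (@le_trans _ _ 2).
    by rewrite -[leRHS]invrK lef_pV2 ?posrE ?invr_gt0 ?mulr_gt0// -div1r.
  by rewrite lerDl mulr_ge0// invr_ge0 mulr_ge0// ltW.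
have t0' : 0 < t by lra.
have tWS : t * W <= S.
  rewrite -(@ler_pXn2r _ 2) ?nnegrE ?mulr_ge0 ?(ltW S0) ?(ltW W0)// exprMn W2 S2.
  have : t ^+ 2 <= 1 by lra.
  by have := sqr_ge0 k; rewrite !expr2; nra.
have tW0 : 0 < t * W by rewrite mulr_gt0.
apply: (@le_trans _ _ (v * (t * W))^-1).
  by rewrite lef_pV2 ?posrE ?mulr_gt0// ler_pM2l.
have -> : (v * (t * W))^-1 = t * (v * W)^-1 + v ^+ 2 * (t * (v * W))^-1.
  by rewrite v2; field; rewrite !gt_eqF.
rewrite addrC lerD2r.
have -> : v ^+ 2 * (t * (v * W))^-1 = (v / W) * t^-1.
  by field; rewrite !gt_eqF.
have vW : v / W <= 1.
  rewrite ler_pdivrMr// mul1r -(@ler_pXn2r _ 2) ?nnegrE ?(ltW v0) ?(ltW W0)// v2 W2 lerDl sqr_ge0//.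
have tV : t^-1 <= 2 by rewrite -[leRHS]invrK lef_pV2 ?posrE ?invr_gt0// -div1r ltW.
by rewrite -[leRHS]mul1r ler_pM ?divr_ge0 ?invr_ge0 ?(ltW v0) ?(ltW W0).
Qed.

Let dom_bound_continuous k t : 0 <= t < 1 -> {for t, continuous (dom_bound k)}.
Proof.
move=> /andP[t0 t1].
have h1 : 0 < 1 - t ^+ 2 by rewrite subr_gt0 expr_lt1.
have h2 : 0 < 1 - t ^+ 2 + k ^+ 2 by rewrite ltr_wpDr// sqr_ge0.
have hx : x ^+ 2 @[x --> t] --> t ^+ 2 by exact: exprn_continuous.
apply: cvgD; first exact: cvg_cst.
apply: cvgM; first exact: cvg_id.
apply: cvgV; first by rewrite mulf_neq0// sqrtr_eq0 -ltNge.
apply: cvgM.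
  apply: (continuous_comp (f := fun t => 1 - t ^+ 2)); last exact: sqrt_continuous.
  by apply: cvgB; [exact: cvg_cst|exact: hx].
apply: (continuous_comp (f := fun t => 1 - t ^+ 2 + k ^+ 2)); last exact: sqrt_continuous.
by apply: cvgD; [apply: cvgB; [exact: cvg_cst|exact: hx]|exact: cvg_cst].
Qed.

Lemma is_derive_LR (G g : R -> R) (a b : R) :
  (forall t, a <= t <= b -> is_derive t 1 G (g t)) -> a < b ->
  derivable_oo_LRcontinuous G a b /\ {in `]a, b[, G^`()%classic =1 g}.
Proof.
move=> dG ab; have cG t : a <= t <= b -> {for t, continuous G}.
  move=> /dG d; apply: differentiable_continuous; apply/derivable1_diffP.
  by have [] := d.
have dG' t : a < t < b -> is_derive t 1 G (g t).
  by move=> /andP[at' tb]; apply: dG; rewrite (ltW at') (ltW tb).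
split; last first.
  move=> t; rewrite in_itv/= => /dG' d; rewrite derive1E.
  by case: d.
split.
- by move=> t; rewrite in_itv/= => /dG' d; case: d.
- by apply: cvg_at_right_filter; apply: cG; rewrite lexx ltW.
- by apply: cvg_at_left_filter; apply: cG; rewrite lexx andbT ltW.
Qed.

(** What matters is the coefficient 1 of the logarithm; the additive constant
    disappears under the iterations of Landen's transformation. *)
Lemma ellipticK_compl_le k : 0 < k < 1 ->
  (\int[mu]_(t in `[0%R, 1%R]) (ell_integrand (Num.sqrt (1 - k ^+ 2)) t)%:E \is a fin_num)%E /\
  ellipticK (Num.sqrt (1 - k ^+ 2)) <= ln k^-1 + 4.
Proof.
move=> k01; have [k0 k1] := andP k01.
have k2 : k ^+ 2 < 1 by rewrite expr_lt1// ltW.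
have k20 : 0 < k ^+ 2 by rewrite exprn_gt0.
have l01 : 0 <= Num.sqrt (1 - k ^+ 2) < 1.
  rewrite sqrtr_ge0/= -(@expr_lt1 _ 2) ?sqrtr_ge0// sqr_sqrtr ?subr_ge0 ?(ltW k2)//.
  by rewrite ltrBlDr ltrDl.
apply: ellipticK_fin => // c /andP[c0 c1].
have dp t : 0 <= t <= c -> is_derive t 1 (dom_primitive k) (dom_bound k t).
  by move=> /andP[? ?]; apply: dom_primitive_derive; apply/andP; split; lra.
have [LR dp'] := is_derive_LR dp c0.
have cf t : 0 <= t < 1 -> {for t, continuous (dom_bound k)} by exact: dom_bound_continuous.
have ce t : 0 <= t < 1 -> {for t, continuous (ell_integrand (Num.sqrt (1 - k ^+ 2)))}.
  by move=> ?; exact: ell_integrand_continuous.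
apply: (@le_trans _ _ (\int[mu]_(t in `[0%R, c]) (dom_bound k t)%:E)%E).
  apply: ge0_le_integral => //.
  - by move=> t _; rewrite lee_fin ell_integrand_ge0.
  - by apply/measurable_EFinP; apply: measurable_co => //; exact: cc_sub_co.
  - by apply/measurable_EFinP; apply: measurable_co => //; exact: cc_sub_co.
  - move=> t /(cc_sub_co c1); rewrite /= in_itv/= lee_fin; exact: ell_integrand_le_dom.
rewrite (continuous_FTC2 c0 _ LR dp'); last first.
  by apply: within_co => //; exact: cc_sub_co.
rewrite -EFinB lee_fin /dom_primitive expr0n/= !subr0 mulr0 sub0r opprK sqrtr1.
have c2 : 0 < 1 - c ^+ 2 by rewrite subr_gt0 expr_lt1// ltW.
have : ln k <= ln (Num.sqrt (1 - c ^+ 2) + Num.sqrt (1 - c ^+ 2 + k ^+ 2)).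
  have c3 : 0 < 1 - c ^+ 2 + k ^+ 2 by lra.
  rewrite ler_ln ?posrE ?addr_gt0 ?sqrtr_gt0//.
  rewrite -[leLHS]add0r lerD ?sqrtr_ge0// -[leLHS]ger0_norm ?(ltW k0)// -sqrtr_sqr.
  by rewrite ler_sqrt; lra.
have : ln (1 + Num.sqrt (1 + k ^+ 2)) <= 2.
  have s2 : Num.sqrt (1 + k ^+ 2) <= 2.
    rewrite -(@ler_pXn2r _ 2) ?nnegrE ?sqrtr_ge0// sqr_sqrtr ?addr_ge0 ?(ltW k20)//.
    by rewrite expr2; lra.
  apply: (le_trans (le_ln1Dx _)); last by [].
  by rewrite (lt_le_trans _ (sqrtr_ge0 _)).
rewrite lnV ?posrE//.
lra.
Qed.

End Elliptic.

(** * Landen's transformation *)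

Section Landen.
Local Open Scope classical_set_scope.
Local Open Scope ring_scope.
Variable R : realType.
Implicit Types (l k t c s : R).
Local Notation mu := (@lebesgue_measure R).

Lemma compl_mod01 l : 0 < l < 1 -> 0 < Num.sqrt (1 - l ^+ 2) < 1.
Proof.
move=> /andP[l0 l1]; have l2 : l ^+ 2 < 1 by rewrite expr_lt1// ltW.
have l20 : 0 < l ^+ 2 by rewrite exprn_gt0.
rewrite sqrtr_gt0 subr_gt0 l2/= -(@expr_lt1 _ 2) ?sqrtr_ge0// sqr_sqrtr; lra.
Qed.

Lemma compl_modK l : 0 < l < 1 -> Num.sqrt (1 - Num.sqrt (1 - l ^+ 2) ^+ 2) = l.
Proof.
move=> /andP[l0 l1]; have l2 : l ^+ 2 < 1 by rewrite expr_lt1// ltW.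
rewrite sqr_sqrtr ?subr_ge0 ?(ltW l2)//.
by rewrite (_ : 1 - (1 - l ^+ 2) = l ^+ 2) ?sqrtr_sqr ?gtr0_norm//; ring.
Qed.

Lemma ellipticK_fin_num l : 0 < l < 1 ->
  (\int[mu]_(t in `[0%R, 1%R]) (ell_integrand l t)%:E \is a fin_num)%E.
Proof.
move=> l01; rewrite -(compl_modK l01).
by have [] := ellipticK_compl_le (compl_mod01 l01).
Qed.

Lemma ell_integrand0_integral c : 0 < c < pi / 2 ->
  (\int[mu]_(t in `[0%R, sin c]) (ell_integrand 0 t)%:E = c%:E)%E.
Proof.
move=> /andP[c0 cpi]; have pi0 := @pi_gt0 R.
have s0 : 0 < sin c by apply: sin_gt0_pihalf; rewrite c0.
have s1 : sin c < 1.
  by rewrite -sin_pihalf ltr_sin// in_itv/=; apply/andP; split; lra.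
have dA t : 0 <= t <= sin c -> is_derive t 1 (@asin R) (ell_integrand 0 t).
  move=> /andP[t0 ts]; rewrite /ell_integrand expr0n/= mul0r subr0 mulr1.
  by apply: is_derive1_asin; apply/andP; split; lra.
have [LR A'] := is_derive_LR dA s0.
rewrite (continuous_FTC2 s0 _ LR A').
  have sK x : 0 <= x <= c -> asin (sin x) = x.
    by move=> /andP[? ?]; apply: sinK; rewrite in_itv/=; apply/andP; split; lra.
  rewrite sK ?(ltW c0) ?lexx// -[in asin 0](@sin0 R) sK ?lexx ?(ltW c0)//.
  by rewrite -EFinB subr0.
apply: within_co; first exact: cc_sub_co.
by move=> t t01; apply: ell_integrand_continuous => //; rewrite lexx ltr01.
Qed.

(** The integrand is at least that of modulus 0, whose primitive is the arc
    sine. *)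
Lemma ellipticK_ge_pihalf l : 0 < l < 1 -> pi / 2 <= ellipticK l.
Proof.
move=> l01; have [l0 l1] := andP l01; have pi0 := @pi_gt0 R.
have l01' : 0 <= l < 1 by rewrite ltW.
apply/ler_addgt0Pr => e e0; rewrite -lerBlDr.
have [h|h] := leP (pi / 2 - e) 0.
  apply: (le_trans h); rewrite /ellipticK /Rintegral fine_ge0//.
  by apply: integral_ge0 => t _; rewrite lee_fin ell_integrand_ge0.
have c01 : 0 < pi / 2 - e < pi / 2 by rewrite h/= ltrBlDr ltrDl.
have s01 : 0 < sin (pi / 2 - e) < 1.
  rewrite sin_gt0_pihalf//= -[ltRHS](@sin_pihalf R) ltr_sin ?in_itv/=; last 2 first.
  - by case/andP: c01 => *; apply/andP; split; lra.
  - by apply/andP; split; lra.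
  by case/andP: c01.
rewrite -lee_fin -ell_integrand0_integral//.
apply: le_trans (ellipticK_ge l01' s01 (ellipticK_fin_num l01)).
have sub := @cc_sub_co R _ (proj2 (andP s01)).
have m k : 0 <= k < 1 -> measurable_fun `[0, sin (pi / 2 - e)] (ell_integrand k).
  by move=> k01; apply: measurable_co => // t t01; exact: ell_integrand_continuous.
apply: ge0_le_integral => //.
- by move=> t _; rewrite lee_fin ell_integrand_ge0.
- by apply/measurable_EFinP; apply: m; rewrite lexx ltr01.
- by apply/measurable_EFinP; apply: m.
move=> t /sub; rewrite /= in_itv/= => t01; rewrite lee_fin /ell_integrand.
have [h1 h2] := ell_integrand_arg_gt0 l01' t01.
rewrite expr0n/= mul0r subr0 mulr1 lef_pV2 ?posrE ?sqrtr_gt0 ?mulr_gt0//.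
rewrite ler_sqrt; last exact: ltW.
by rewrite ler_piMr ?(ltW h1)// gerBl mulr_ge0 ?sqr_ge0.
Qed.

(** Gauss's substitution and its derivative. *)
Let tau l s : R := (1 + l) * s / (1 + l * s ^+ 2).
Let dtau l s : R := (1 + l) * (1 - l * s ^+ 2) / (1 + l * s ^+ 2) ^+ 2.

Let den_gt0 l s : 0 < l -> 0 < 1 + l * s ^+ 2.
Proof. by move=> l0; rewrite ltr_wpDr// mulr_ge0 ?sqr_ge0// ltW. Qed.

Let tau_derive l s : 0 < l -> is_derive s 1 (tau l) (dtau l s).
Proof.
move=> l0; have d0 := den_gt0 s l0.
have e1 : is_derive s 1 (fun s : R => (1 + l) * s) (1 + l).
  by apply: is_derive_eq; rewrite /GRing.scale/=; ring.
have e2 : is_derive s 1 (fun s : R => 1 + l * s ^+ 2) (2 * l * s).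
  by apply: is_derive_eq; rewrite /GRing.scale/=; ring.
have e3 := is_deriveV (f := fun s : R => 1 + l * s ^+ 2) (lt0r_neq0 d0) e2.
have e4 := is_deriveM e1 e3.
apply: (is_derive_eq e4); rewrite /dtau /GRing.scale/=.
by field; rewrite gt_eqF.
Qed.

Let dtau_continuous l : 0 < l -> continuous (dtau l).
Proof.
move=> l0 s; have d0 := den_gt0 s l0.
have hx : x ^+ 2 @[x --> s] --> s ^+ 2 by exact: exprn_continuous.
have hl : l * x ^+ 2 @[x --> s] --> l * s ^+ 2 by apply: cvgM; [exact: cvg_cst|exact: hx].
apply: cvgM; first by apply: cvgM; [exact: cvg_cst|apply: cvgB; [exact: cvg_cst|exact: hl]].
apply: cvgV; first by rewrite expf_neq0// gt_eqF.
apply: (continuous_comp (f := fun s => 1 + l * s ^+ 2) (g := fun x => x ^+ 2)); last exact: exprn_continuous.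
by apply: cvgD; [exact: cvg_cst|exact: hl].
Qed.

Let tau_incr l s t : 0 < l < 1 -> 0 <= s <= 1 -> 0 <= t <= 1 -> s < t -> tau l s < tau l t.
Proof.
move=> /andP[l0 l1] /andP[s0 s1] /andP[t0 t1] st.
have ds := den_gt0 s l0; have dt := den_gt0 t l0.
rewrite /tau ltr_pdivrMr// mulrAC ltr_pdivlMr// -!mulrA ltr_pM2l ?addr_gt0//.
rewrite -subr_gt0.
have -> : t * (1 + l * s ^+ 2) - s * (1 + l * t ^+ 2) = (t - s) * (1 - l * (s * t)) by ring.
rewrite mulr_gt0 ?subr_gt0//.
have : s * t <= 1 by rewrite mulr_ile1.
have : 0 <= s * t by rewrite mulr_ge0.
nra.
Qed.

Let tau0 l : tau l 0 = 0. Proof. by rewrite /tau mulr0 mul0r. Qed.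
Let tau1 l : 0 < l -> tau l 1 = 1.
Proof. by move=> l0; rewrite /tau expr1n !mulr1 divff// gt_eqF// addr_gt0. Qed.

(** The ascending Landen transform of the modulus l. *)
Definition asc_mod l : R := 2 * Num.sqrt l / (1 + l).

Lemma asc_mod_sqr l : 0 < l -> asc_mod l ^+ 2 = 4 * l / (1 + l) ^+ 2.
Proof.
move=> l0; rewrite /asc_mod expr_div_n exprMn sqr_sqrtr ?(ltW l0)//.
by congr (_ * _ / _); ring.
Qed.

Lemma asc_mod01 l : 0 < l < 1 -> 0 < asc_mod l < 1.
Proof.
move=> /andP[l0 l1]; have k0 : 0 < asc_mod l.
  by rewrite divr_gt0 ?mulr_gt0 ?sqrtr_gt0 ?addr_gt0.
rewrite k0 -(@expr_lt1 _ 2) ?(ltW k0)// asc_mod_sqr// ltr_pdivrMr ?exprn_gt0 ?addr_gt0//.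
have : 0 < (1 - l) ^+ 2 by rewrite exprn_gt0 ?subr_gt0.
by rewrite !expr2; nra.
Qed.

Lemma ell_integrand_subst l s : 0 < l < 1 -> 0 <= s < 1 ->
  ell_integrand (asc_mod l) (tau l s) * dtau l s = (1 + l) * ell_integrand l s.
Proof.
move=> l01 s01; have [l0 l1] := andP l01; have [s0 s1] := andP s01.
have l01' : 0 <= l < 1 by rewrite ltW.
have [h1 h2] := ell_integrand_arg_gt0 l01' s01.
have d0 := den_gt0 s l0.
have n0 : 0 < 1 - l * s ^+ 2.
  have : s ^+ 2 < 1 by rewrite expr_lt1.
  by have := sqr_ge0 s; nra.
have e : (1 - tau l s ^+ 2) * (1 - asc_mod l ^+ 2 * tau l s ^+ 2) =
    (1 - s ^+ 2) * (1 - l ^+ 2 * s ^+ 2) * ((1 - l * s ^+ 2) / (1 + l * s ^+ 2) ^+ 2) ^+ 2.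
  rewrite asc_mod_sqr// /tau; field.
  by rewrite !gt_eqF// addr_gt0.
rewrite /ell_integrand e sqrtrM ?mulr_ge0 ?(ltW h1) ?(ltW h2)// sqrtr_sqr gtr0_norm ?divr_gt0 ?exprn_gt0//.
have S0 : 0 < Num.sqrt ((1 - s ^+ 2) * (1 - l ^+ 2 * s ^+ 2)) by rewrite sqrtr_gt0 mulr_gt0.
move: S0; set S := Num.sqrt _ => S0; rewrite /dtau; field.
by rewrite !gt_eqF.
Qed.

(** The substitution tau carries one integrand to a multiple of the other.  The
    two sides are in fact equal; the inequality is enough below, and it needs
    only the comparison of integrals over [0, c] and [0, tau l c]. *)
Lemma ellipticK_landen l : 0 < l < 1 -> (1 + l) * ellipticK l <= ellipticK (asc_mod l).
Proof.
move=> l01; have [l0 l1] := andP l01; have k01 := asc_mod01 l01.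
have l01' : 0 <= l < 1 by rewrite ltW.
have k01' : 0 <= asc_mod l < 1 by case/andP: k01 => /ltW -> ->.
have l1' : 0 < 1 + l by rewrite addr_gt0.
rewrite mulrC -ler_pdivlMr//.
have [] // := @ellipticK_fin R l (ellipticK (asc_mod l) / (1 + l)) l01' _.
move=> c c01; have [c0 c1] := andP c01.
have tc0 : 0 < tau l c by rewrite -(tau0 l); apply: tau_incr; rewrite ?lexx ?ler01 ?ltW.
have tc1 : tau l c < 1 by rewrite -(tau1 l0); apply: tau_incr; rewrite ?lexx ?ler01 ?ltW.
have dt s : 0 <= s <= c -> is_derive s 1 (tau l) (dtau l s) by move=> _; exact: tau_derive.
have [LR _] := is_derive_LR dt c0.
have dE : (tau l)^`()%classic = dtau l.
  by apply/funext => s; rewrite derive1E; have [_ ->] := tau_derive s l0.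
have subc := @cc_sub_co R _ c1; have subt := @cc_sub_co R _ tc1.
have E : (\int[mu]_(t in `[0%R, tau l c]) (ell_integrand (asc_mod l) t)%:E =
   \int[mu]_(t in `[0%R, c]) ((1 + l)%:E * (ell_integrand l t)%:E))%E.
  rewrite -[X in `[X, _]](tau0 l) integration_by_substitution_increasing ?(ltW c0)//.
  - apply: eq_integral => s; rewrite inE => /subc/=; rewrite in_itv/= => s01.
    by rewrite dE -EFinM -ell_integrand_subst.
  - move=> s t; rewrite !in_itv/= => /andP[s0 sc] /andP[t0 tc].
    by apply: tau_incr => //; apply/andP; split; lra.
  - by rewrite dE => s _; exact: dtau_continuous.
  - by rewrite dE; apply/cvg_ex; exists (dtau l 0); apply: cvg_at_right_filter; exact: dtau_continuous.
  - by rewrite dE; apply/cvg_ex; exists (dtau l c); apply: cvg_at_left_filter; exact: dtau_continuous.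
  - rewrite tau0; apply: within_co => // t t01; exact: ell_integrand_continuous.
have tc01 : 0 < tau l c < 1 by rewrite tc0.
have := ellipticK_ge k01' tc01 (ellipticK_fin_num k01).
rewrite E ge0_integralZl_EFin//; last 3 first.
- by move=> t _; rewrite lee_fin ell_integrand_ge0.
- by apply/measurable_EFinP; apply: measurable_co => // t t01; exact: ell_integrand_continuous.
- exact: ltW.
by move=> h; rewrite -(@lee_pmul2l _ (1 + l)%:E) ?lte_fin// -EFinM mulrC divfK ?gt_eqF.
Qed.

End Landen.

(** * The Groetzsch ring function *)

Section Grotzsch.
Local Open Scope classical_set_scope.
Local Open Scope ring_scope.
Variable R : realType.
Implicit Types (l k q x y C : R).
Local Notation mu := (@grotzsch_mu R).
Local Notation cm l := (Num.sqrt (1 - l ^+ 2)).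

Lemma ellipticK_gt0 l : 0 < l < 1 -> 0 < ellipticK l.
Proof. by move=> l01; rewrite (lt_le_trans _ (ellipticK_ge_pihalf l01)) ?divr_gt0 ?pi_gt0. Qed.

Lemma grotzsch_mu_gt0 l : 0 < l < 1 -> 0 < mu l.
Proof.
move=> l01; rewrite /grotzsch_mu mulr_gt0 ?divr_gt0 ?pi_gt0 ?ellipticK_gt0//.
exact: compl_mod01.
Qed.

Lemma grotzsch_mu_dual l : 0 < l < 1 -> mu l * mu (cm l) = pi ^+ 2 / 4.
Proof.
move=> l01; rewrite /grotzsch_mu compl_modK//.
have := ellipticK_gt0 l01; have := ellipticK_gt0 (compl_mod01 l01).
move: (ellipticK l) (ellipticK _) => x y y0 x0; field.
by rewrite !gt_eqF.
Qed.

Lemma grotzsch_mu_le_crude l : 0 < l < 1 -> mu l <= ln l^-1 + 4.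
Proof.
move=> l01; have [_ h] := ellipticK_compl_le l01; apply: le_trans h.
have K0 := ellipticK_gt0 l01; have K1 := ellipticK_gt0 (compl_mod01 l01).
rewrite /grotzsch_mu mulrCA -[leRHS]mulr1 ler_pM2l// ler_pdivrMr// mul1r.
exact: ellipticK_ge_pihalf.
Qed.

(** The descending Landen transform, inverse to asc_mod. *)
Definition desc_mod l : R := (1 - cm l) / (1 + cm l).

Lemma desc_modE l : 0 < l < 1 -> desc_mod l = (l / (1 + cm l)) ^+ 2.
Proof.
move=> l01; have [c0 c1] := andP (compl_mod01 l01); have [l0 l1] := andP l01.
have l2 : l ^+ 2 = (1 - cm l) * (1 + cm l).
  by rewrite -subr_sqr expr1n sqr_sqrtr; [ring | rewrite subr_ge0 expr_le1 // ltW].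
rewrite expr_div_n /desc_mod; move: l2 c0; set c := cm l => -> c0.
by field; rewrite gt_eqF// addr_gt0.
Qed.

Lemma desc_mod01 l : 0 < l < 1 -> 0 < desc_mod l < 1.
Proof.
move=> l01; have [c0 c1] := andP (compl_mod01 l01).
rewrite /desc_mod divr_gt0 ?subr_gt0 ?addr_gt0//= ltr_pdivrMr ?addr_gt0//.
by rewrite mul1r ltrD2l gtrN.
Qed.

Lemma desc_modK l : 0 < l < 1 -> asc_mod (desc_mod l) = l.
Proof.
move=> l01; have [c0 c1] := andP (compl_mod01 l01); have [l0 l1] := andP l01.
rewrite /asc_mod {1}desc_modE// sqrtr_sqr gtr0_norm ?divr_gt0 ?addr_gt0//.
rewrite /desc_mod; move: c0 c1; set c := cm l => c0 c1; field.
by apply/andP; split; rewrite gt_eqF//; lra.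
Qed.

Lemma cm_asc_mod l : 0 < l < 1 -> cm (asc_mod l) = (1 - l) / (1 + l).
Proof.
move=> /andP[l0 l1]; rewrite asc_mod_sqr//.
have -> : 1 - 4 * l / (1 + l) ^+ 2 = ((1 - l) / (1 + l)) ^+ 2.
  by field; rewrite gt_eqF// addr_gt0.
by rewrite sqrtr_sqr gtr0_norm// divr_gt0 ?subr_gt0 ?addr_gt0.
Qed.

(** Passing from l to asc_mod l multiplies K by 1 + l, and K at the
    complementary modulus by (1 + l) / 2. *)
Lemma grotzsch_mu_asc l : 0 < l < 1 -> mu (asc_mod l) <= mu l / 2.
Proof.
move=> l01; have [l0 l1] := andP l01; have k01 := asc_mod01 l01.
have l1' : 0 < 1 + l by rewrite addr_gt0.
pose d := desc_mod (cm l).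
have dE : d = cm (asc_mod l) by rewrite /d /desc_mod compl_modK// cm_asc_mod.
have d01 : 0 < d < 1 by apply: desc_mod01; exact: compl_mod01.
have h1 := ellipticK_landen d01; rewrite /d desc_modK ?compl_mod01// -/d in h1.
have h2 := ellipticK_landen l01.
have K0 := ellipticK_gt0 l01; have K1 := ellipticK_gt0 k01.
have K2 := ellipticK_gt0 d01.
have dl : 1 + d = 2 / (1 + l) by rewrite dE cm_asc_mod//; field; rewrite gt_eqF.
rewrite dl mulrAC ler_pdivrMr// in h1.
rewrite /grotzsch_mu -dE -[leRHS]mulrA ler_pM2l ?divr_gt0 ?pi_gt0//.
rewrite ler_pdivrMr//; apply: (@le_trans _ _ (ellipticK (cm l) * ((1 + l) / 2))).
  by rewrite mulrA ler_pdivlMr// mulrC.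
have K3 := ellipticK_gt0 (compl_mod01 l01).
have h3 : 1 + l <= ellipticK (asc_mod l) / ellipticK l by rewrite ler_pdivlMr.
move: K0 K1 K3 h3; move: (ellipticK l) (ellipticK (asc_mod l)) (ellipticK (cm l)) => x y A x0 y0 A0 h3.
have -> : A / x / 2 * y = A * ((y / x) / 2) by field; rewrite gt_eqF.
by rewrite ler_pM2l// ler_pM2r ?invr_gt0.
Qed.

Lemma le_of_halving x y C : (forall n, x <= y + C / 2 ^+ n) -> x <= y.
Proof.
move=> h; have cv : y + C / 2 ^+ n @[n --> \oo] --> y + C * 0.
  apply: cvgD; first exact: cvg_cst.
  apply: cvgM; first exact: cvg_cst.
  under eq_cvg do rewrite -exprVn.
  by apply: cvg_expr; rewrite ger0_norm ?invr_ge0// invf_lt1// ltr1n.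
rewrite mulr0 addr0 in cv.
by apply: (cvg_ge_near cv); exact: nearW.
Qed.


Lemma ln2_le1 : ln 2 <= 1 :> R.
Proof.
have : ln (1 + 1) <= 1 :> R by apply: le_ln1Dx; lra.
by rewrite (_ : 1 + 1 = 2 :> R)//; ring.
Qed.

Lemma halving_step C n : C / 2 ^+ n.+1 = (C / 2 ^+ n) / 2.
Proof. by rewrite exprSr invfM mulrA. Qed.

(** The difference mu(l) - ln (4 / l) is at most half of its value at the
    descending transform l1 of l, since l1 >= l^2 / 4, and it is at most 4
    everywhere. *)
Lemma grotzsch_mu_le_ln l : 0 < l < 1 -> mu l <= ln (4 / l).
Proof.
move=> l01; apply: (@le_of_halving _ _ 4) => n.
elim: n l l01 => [|n IH] l l01; have [l0 l1] := andP l01.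
  apply: (le_trans (grotzsch_mu_le_crude l01)); rewrite expr0 divr1 lerD2r.
  by rewrite ler_ln ?posrE ?divr_gt0 ?invr_gt0// ler_peMl ?invr_ge0 ?(ltW l0)//; lra.
have d01 := desc_mod01 l01; have [d0 d1] := andP d01.
have := grotzsch_mu_asc d01; rewrite desc_modK// => h.
have := IH _ d01; rewrite halving_step.
have dl : ln (4 / desc_mod l) <= 2 * ln (4 / l).
  have p4 : 0 < 4 / desc_mod l by rewrite divr_gt0.
  have p2 : 0 < (4 / l) ^+ 2 by rewrite exprn_gt0// divr_gt0.
  rewrite [leRHS]mulr_natl -lnXn ?divr_gt0// ler_ln ?posrE ?p4 ?p2//.
  have [c0 c1] := andP (compl_mod01 l01).
  rewrite desc_modE// ler_pdivrMr ?exprn_gt0 ?divr_gt0 ?addr_gt0// -exprMn.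
  rewrite (_ : 4 / l * (l / (1 + cm l)) = 4 / (1 + cm l)); last first.
    by field; rewrite !gt_eqF ?addr_gt0.
  rewrite -[leLHS](_ : 2 ^+ 2 = 4); last by ring.
  rewrite lerXn2r ?nnegrE ?divr_ge0 ?addr_ge0 ?(ltW c0)//.
  by rewrite ler_pdivlMr ?addr_gt0//; lra.
lra.
Qed.

(** Let k be the modulus of nome q.  Squaring the nome replaces k by its
    descending Landen transform, so mu(k) + (ln q) / 2 is at most half of its
    value at the nome q^2; it is bounded above because k^2 >= q / 2. *)
Lemma grotzsch_mu_comod q : 0 < q < 1 -> mu (cm (comod q)) <= - ln q / 2.
Proof.
move=> q01; apply: (@le_of_halving _ _ 5) => n.
elim: n q q01 => [|n IH] q q01; have [q0 q1] := andP q01.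
  have k01 := compl_mod01 (comod01 q01); have [k0 k1] := andP k01.
  apply: (le_trans (grotzsch_mu_le_crude k01)); rewrite expr0 divr1 lnV ?posrE//.
  have h := comod_compl_ge q01.
  have : ln (q / 2) <= 2 * ln (cm (comod q)).
    rewrite [leRHS]mulr_natl -lnXn// ler_ln ?posrE ?divr_gt0 ?exprn_gt0//.
    rewrite sqr_sqrtr// subr_ge0; have [a0 a1] := andP (comod01 q01).
    by rewrite expr_le1// ltW.
  rewrite lnM ?posrE ?invr_gt0// lnV ?posrE//; have := ln2_le1; lra.
have k01 := comod01 q01; have := grotzsch_mu_asc (desc_mod01 (compl_mod01 k01)).
rewrite desc_modK ?compl_mod01//.
have -> : desc_mod (cm (comod q)) = cm (comod (q ^+ 2)).
  by rewrite comod_landen// -/(asc_mod (comod q)) cm_asc_mod// /desc_mod compl_modK.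
have E : ln (q ^+ 2) = 2 * ln q by rewrite lnXn// mulr_natl.
have := IH _ (sq01 q01); rewrite E halving_step.
move: (mu _) (mu _) (ln q) (5 / _) => u v w' t; lra.
Qed.

End Grotzsch.

(** * The rank bound *)

Section Bound.
Local Open Scope classical_set_scope.
Local Open Scope ring_scope.
Variable R : realType.
Implicit Types (a b eps : R).

Lemma ln_nome_le (l q : R) : 0 < q < 1 -> comod q = l -> ln q <= - (pi ^+ 2 / (2 * grotzsch_mu l)).
Proof.
move=> q01 kq; have l01 := comod01 q01; rewrite kq in l01.
have := grotzsch_mu_comod q01; have := grotzsch_mu_dual l01; rewrite kq.
have := grotzsch_mu_gt0 l01; have := grotzsch_mu_gt0 (compl_mod01 l01).
move: (grotzsch_mu l) (grotzsch_mu _) => x y y0 x0 xy yq.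
have -> : pi ^+ 2 / (2 * x) = 2 * y.
  by rewrite (_ : pi ^+ 2 = 4 * (x * y)); [field; rewrite gt_eqF | rewrite xy; field].
lra.
Qed.

(** With M = 2 q^k, the logarithm of M^2 is
    ln 4 + 2 k ln q <= ln 4 - k pi^2 / mu(a/b), which is at most ln eps exactly
    when k >= mu(a/b) ln (4 / eps) / pi^2. *)
Lemma pick_epsilon_rank a b n (x : 'I_n -> R) (s : 'cV[R[i]]_n) eps k :
  0 < a -> a < b -> (forall j, a <= x j <= b) -> 0 < eps -> (0 < k)%N ->
  grotzsch_mu (a / b) * ln (4 / eps) / pi ^+ 2 <= k%:R ->
  (epsilon_rank eps (pick_mx x s) <= 2 * k)%N.
Proof.
move=> a0 ab xab e0 k0 hk; have b0 : 0 < b by exact: lt_trans ab.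
have l01 : 0 < a / b < 1 by rewrite divr_gt0//= ltr_pdivrMr// mul1r.
have [q q01 kq] := comod_surj l01; have [q0 q1] := andP q01.
have [z z0 zb] := zolotarev_interval a0 ab q01 kq k0.
have x0 j : 0 < x j by have /andP[h _] := xab j; exact: lt_le_trans h.
have M0 : 0 <= 2 * q ^+ k by rewrite mulr_ge0// exprn_ge0// ltW.
have := pick_singular_value s M0 z0 x0 (fun j => zb _ (xab j)).
move=> h; apply: epsilon_rank_le; first exact: ltW.
apply: (le_trans h); apply: ler_wpM2r; first exact: singular_values_ge0.
rewrite -ler_ln ?posrE ?exprn_gt0 ?mulr_gt0 ?exprn_gt0//.
have -> : ln ((2 * q ^+ k) ^+ 2) = ln 4 + 2 * k%:R * ln q.
  rewrite exprMn lnM ?posrE ?exprn_gt0// -exprM (lnXn _ q0) -(mulr_natl (ln q)) natrM.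
  by rewrite (_ : 2 ^+ 2 = 4 :> R); ring.
have mu0 := grotzsch_mu_gt0 l01.
have hq := ln_nome_le q01 kq.
have pi0 : 0 < pi ^+ 2 :> R by rewrite exprn_gt0 ?pi_gt0.
rewrite ler_pdivrMr// in hk.
have k00 : 0 <= k%:R :> R by [].
have h1 : 2 * k%:R * ln q <= 2 * k%:R * - (pi ^+ 2 / (2 * grotzsch_mu (a / b))).
  by rewrite ler_wpM2l// mulr_ge0.
have h2 : 2 * k%:R * - (pi ^+ 2 / (2 * grotzsch_mu (a / b))) = - (k%:R * pi ^+ 2 / grotzsch_mu (a / b)).
  by field; rewrite gt_eqF.
have h3 : ln (4 / eps) <= k%:R * pi ^+ 2 / grotzsch_mu (a / b).
  by rewrite ler_pdivlMr// mulrC.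
rewrite lnM ?posrE ?invr_gt0// lnV ?posrE// in h3.
lra.
Qed.

Lemma pick_epsilon_rank_ceil a b n (x : 'I_n -> R) (s : 'cV[R[i]]_n) eps (y : R) :
  0 < a -> a < b -> (forall j, a <= x j <= b) -> 0 < eps -> eps < 1 ->
  grotzsch_mu (a / b) * ln (4 / eps) / pi ^+ 2 <= y ->
  (epsilon_rank eps (pick_mx x s))%:Z <= 2 * Num.ceil y.
Proof.
move=> a0 ab xab e0 e1 hy; have b0 : 0 < b by exact: lt_trans ab.
have l01 : 0 < a / b < 1 by rewrite divr_gt0//= ltr_pdivrMr// mul1r.
have y0 : 0 < y.
  apply: lt_le_trans hy; rewrite divr_gt0 ?exprn_gt0 ?pi_gt0// mulr_gt0 ?grotzsch_mu_gt0//.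
  by rewrite ln_gt0// ltr_pdivlMr//; lra.
have c0 : 0 < Num.ceil y by rewrite -ceil_gt0 in y0.
have [k kE] : exists k : nat, Num.ceil y = k%:Z by exists `|Num.ceil y|%N; lia.
have := pick_epsilon_rank s (k := k) a0 ab xab e0.
rewrite kE in c0 *; move=> /(_ _ _)/=.
have -> : (0 < k)%N by lia.
have -> : grotzsch_mu (a / b) * ln (4 / eps) / pi ^+ 2 <= k%:R.
  by apply: (le_trans hy); have := ceil_ge y; rewrite kE.
by move=> /(_ isT isT); lia.
Qed.

End Bound.

Theorem mainTheorem10 (R : realType) (a b : R) (n : nat) (x : 'I_n -> R)
    (s : 'cV[R[i]]_n) (eps : R)
    (a_gt0 : 0 < a) (lt_ab : a < b)
    (x_incr : forall j k : 'I_n, (j < k)%N -> x j < x k)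
    (x_ab : forall j : 'I_n, a <= x j <= b)
    (eps_gt0 : 0 < eps) (eps_lt1 : eps < 1) :
  ((epsilon_rank eps (pick_mx x s))%:Z <=
     2 * Num.ceil (ln (4 * b / a) * ln (4 / eps) / pi ^+ 2)) /\
  ((epsilon_rank eps (pick_mx x s))%:Z <=
     2 * Num.ceil (grotzsch_mu (a / b) * ln (4 / eps) / pi ^+ 2)).
Proof.
have b_gt0 : 0 < b by exact: lt_trans lt_ab.
have l01 : 0 < a / b < 1 by rewrite divr_gt0//= ltr_pdivrMr// mul1r.
split; apply: (pick_epsilon_rank_ceil s a_gt0 lt_ab) => //.
rewrite ler_pM2r ?invr_gt0 ?exprn_gt0 ?pi_gt0// ler_pM2r; last first.
  by rewrite ln_gt0// ltr_pdivlMr//; lra.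
have -> : 4 * b / a = 4 / (a / b) by field; rewrite !gt_eqF.
exact: grotzsch_mu_le_ln.
Qed.
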